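(* Let $n,k$ be integers with $0\le k$ and $n\ge k+1$, and let $\mathcal{B}(n,k)$ be the higher Bruhat order, i.e. the set of all consistent subsets of $\binom{[n]}{k+1}$ partially ordered by single step inclusion. Then the proper part $\mathcal{B}(n,k)\setminus\{\emptyset,\binom{[n]}{k+1}\}$ has the homotopy type of an $(n-k-2)$-sphere.
   Context: $[n]=\{1,\dots,n\}$ and $\binom{[n]}{k+1}$ is the set of $(k+1)$-element subsets of $[n]$. For a $(k+2)$-subset $S$ of $[n]$, the $(k+1)$-packet of $S$ is the set of all $(k+1)$-subsets of $S$, ordered lexicographically. A subset $U\subseteq\binom{[n]}{k+1}$ is consistent if for every $(k+2)$-subset $S\subseteq[n]$ the intersection of $U$ with the packet of $S$ is empty, the whole packet, or a beginning segment or an ending segment of the packet in its lexicographic order. Single step inclusion order on consistent sets: $U\le U'$ if there is a sequence $U=U_0,U_1,\dots,U_m=U'$ of consistent sets with $U_{i-1}\subseteq U_i$ and $\#(U_i\setminus U_{i-1})=1$ for $i=1,\dots,m$. The poset $\mathcal{B}(n,k)$ is bounded with minimum $\emptyset$ and maximum $\binom{[n]}{k+1}$; its proper part is obtained by removing these two elements, and its homotopy type means that of its order complex (the simplicial complex of finite chains). The $(-1)$-sphere is the empty space. *)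

(* Defs.v *)
From HB Require Import structures.
From mathcomp Require Import all_boot all_order all_algebra.
From mathcomp Require Import all_classical all_reals all_analysis.

Set Implicit Arguments.
Unset Strict Implicit.
Unset Printing Implicit Defensive.

Import Order.TTheory GRing.Theory Num.Theory.
Import numFieldNormedType.Exports.

(* The ground set {1, ..., n} is encoded as 'I_n = {0, ..., n-1}; the shift    *)
(* preserves the lexicographic order on subsets.                              *)

Definition ksubsets (n j : nat) : {set {set 'I_n}} :=
  [set A : {set 'I_n} | #|A| == j].

(* [enum A] lists the elements of [A] in increasing order. *)
Definition lex_le (n : nat) (A B : {set 'I_n}) : bool :=
  ((enum A : seqlexi 'I_n) <= (enum B : seqlexi 'I_n))%O.

Definition packet (n k : nat) (S : {set 'I_n}) : {set {set 'I_n}} :=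
  [set A in ksubsets n k.+1 | A \subset S].

Definition beginning_segment (n : nat) (P V : {set {set 'I_n}}) : bool :=
  (V \subset P) &&
  [forall A in V, forall B in P, lex_le B A ==> (B \in V)].

Definition ending_segment (n : nat) (P V : {set {set 'I_n}}) : bool :=
  (V \subset P) &&
  [forall A in V, forall B in P, lex_le A B ==> (B \in V)].

Definition consistent (n k : nat) (U : {set {set 'I_n}}) : bool :=
  (U \subset ksubsets n k.+1) &&
  [forall S in ksubsets n k.+2,
     [|| U :&: packet k S == finset.set0,
         U :&: packet k S == packet k S,
         beginning_segment (packet k S) (U :&: packet k S)
       | ending_segment (packet k S) (U :&: packet k S)]].

Definition higher_bruhat (n k : nat) : Type :=
  {U : {set {set 'I_n}} | consistent k U}.

HB.instance Definition _ (n k : nat) := SubFinite.on (higher_bruhat n k).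

Definition single_step (n k : nat) : rel (higher_bruhat n k) :=
  fun U V => (val U \subset val V) && (#|val V :\: val U| == 1)%N.

(* [connect single_step U V] says that there is a finite, possibly empty,     *)
(* sequence of single steps from [U] to [V]; see [connectP].                  *)
Definition hb_le (n k : nat) : rel (higher_bruhat n k) :=
  connect (@single_step n k).

Lemma hb_le_refl (n k : nat) : reflexive (@hb_le n k).
Proof. exact: connect0. Qed.

Lemma hb_le_trans (n k : nat) : transitive (@hb_le n k).
Proof. exact: connect_trans. Qed.

Lemma hb_le_sub (n k : nat) (U V : higher_bruhat n k) :
  hb_le U V -> val U \subset val V.
Proof.
case/connectP=> p; elim: p U => [|W p IHp] U /= => [_ ->//|].
by case/andP=> /andP[sUW _] pW eV; apply: fintype.subset_trans sUW (IHp _ pW eV).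
Qed.

Lemma hb_le_anti (n k : nat) : antisymmetric (@hb_le n k).
Proof.
move=> U V /andP[/hb_le_sub sUV /hb_le_sub sVU].
by apply/val_inj/eqP; rewrite finset.eqEsubset sUV.
Qed.

Fact higher_bruhat_display : Order.disp_t.
Proof. exact: Order.default_display. Qed.

HB.instance Definition _ (n k : nat) :=
  Order.Le_isPOrder.Build higher_bruhat_display (higher_bruhat n k)
    (@hb_le_refl n k) (@hb_le_anti n k) (@hb_le_trans n k).

Definition proper_part (n k : nat) : Type :=
  {U : higher_bruhat n k | (val U != finset.set0) && (val U != ksubsets n k.+1)}.

HB.instance Definition _ (n k : nat) := SubFinite.on (proper_part n k).
HB.instance Definition _ (n k : nat) :=
  [SubChoice_isSubPOrder of proper_part n k by <: with higher_bruhat_display].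

Definition order_complex (d : Order.disp_t) (P : finPOrderType d) :
    {set {set P}} :=
  [set C : {set P} | [forall x in C, forall y in C, (x >=< y)%O]].

Local Open Scope classical_set_scope.
Local Open Scope ring_scope.

(* The points of the realization are the barycentric coordinates supported on *)
(* a face, with the topology induced by R^V.                                  *)
Definition realization (R : realType) (V : finType) (K : {set {set V}}) :
    set {ptws V -> R} :=
  [set x : {ptws V -> R} |
            [/\ forall v, 0 <= x v,
                \sum_v x v = 1
              & [set v | x v != 0]%SET \in K]].
Arguments realization R {V} K.

(* Unit sphere of R^d: the (d-1)-sphere, which is empty for d = 0. *)
Definition unit_sphere (R : realType) (d : nat) : set 'rV[R]_d :=
  [set x : 'rV[R]_d | \sum_i x 0 i ^+ 2 = 1].
Arguments unit_sphere R d : clear implicits.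

(* Homotopies are given on [0,1] x X; their values elsewhere are irrelevant.  *)
Definition homotopic (R : realType) (X Y : topologicalType) (f g : X -> Y) :
    Prop :=
  exists H : R * X -> Y,
    [/\ {within `[0 : R, 1] `*` [set: X], continuous H},
        forall x, H (0, x) = f x
      & forall x, H (1, x) = g x].

Definition homotopy_equivalent (R : realType) (X Y : topologicalType) : Prop :=
  exists (f : X -> Y) (g : Y -> X),
    [/\ continuous f, continuous g,
        homotopic R (g \o f) idfun
      & homotopic R (f \o g) idfun].

(* Main.v *)
From HB Require Import structures.
Require Import Defs.
From mathcomp Require Import all_boot all_order all_algebra.
From mathcomp Require Import all_classical all_reals all_analysis.
From mathcomp Require Import zify ring lra.
Import numFieldNormedType.Exports.

Set Implicit Arguments.
Unset Strict Implicit.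
Unset Printing Implicit Defensive.

Import Order.TTheory GRing.Theory Num.Theory.

(** Call s = max A the level of a (k+1)-set A, and let T_s = {s-k, ..., s} be
    the lexicographically last set of level s. For every m, replacing the levels
    s >= m of a consistent set U by everything or nothing, according to whether
    T_s belongs to U, is a poset endomorphism of B(n,k) preserving the proper
    part. Consecutive endomorphisms are bounded above by a common one, hence are
    homotopic, and they lead from the identity (m = n) to a retraction (m = 0)
    onto a Boolean lattice on n - k atoms, which is indexed by the levels. Two
    consistent sets U, W with U in W that differ at a single level are comparable
    in the single step order because a consistent set orients all packets below
    a level acyclically. The proper part of the Boolean lattice is the
    barycentric subdivision of the boundary of a simplex; summing the barycentric
    coordinates over the sets containing a given atom identifies it with the
    sphere, and the inverse is the layer-cake decomposition of a vector. *)

(** * Consistent sets and the single step order *)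

(** The two increasing lists agree up to the place where the first shows [a]; there the second shows
    the next element of [S], which exists because [b] is larger than [a]. *)
Lemma lex_lt_setD1 n (S : {set 'I_n}) (a b : 'I_n) : a \in S -> b \in S ->
  a < b -> ((enum (S :\ b) : seqlexi 'I_n) < (enum (S :\ a) : seqlexi 'I_n))%O.
Proof.
move=> aS bS ab.
have E (c : 'I_n) : enum (S :\ c) = [seq x <- enum S | x != c].
  rewrite /enum_mem -filter_predI.
  by apply: eq_filter => x; rewrite /= !finset.inE.
have srt : sorted (fun x y : 'I_n => x < y) (enum S).
  rewrite /enum_mem; apply: sorted_filter; first by move=> x y z; apply: ltn_trans.
  have : sorted ltn (map val (enum 'I_n)) by rewrite val_enum_ord iota_ltn_sorted.
  by rewrite sorted_map enumT.
rewrite !E.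
have : a \in enum S by rewrite mem_enum.
have : b \in enum S by rewrite mem_enum.
elim: (enum S) srt => // x s IHs /= srt.
have srts := path_sorted srt.
have xs y : y \in s -> x < y.
  move: y; apply/allP; apply: order_path_min srt => u v w; exact: ltn_trans.
rewrite !finset.inE.
case: (eqVneq x a) => [xa|xa]; case: (eqVneq x b) => [xb|xb] /=.
- by rewrite -xa -xb ltnn in ab.
- move=> bs _.
  have xNa : x \notin s by apply/negP => /xs; rewrite ltnn.
  rewrite -xa.
  have -> : [seq y <- s | y != x] = s.
    by apply/all_filterP/allP => y ys; apply: contraNneq xNa => <-.
  case: s bs xs {IHs srt srts xNa} => // y s _ xs.
  rewrite ltxi_cons; have xy : x < y by apply: xs; rewrite finset.inE eqxx.
  rewrite (ltW (xy : (x < y)%O)) /=; apply/implyP; rewrite leNgt.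
  by rewrite (xy : (x < y)%O).
- by move=> _ /xs; rewrite xb => /(ltn_trans ab); rewrite ltnn.
move=> bs as_.
by rewrite ltxi_cons lexx /= IHs.
Qed.

Lemma lex_le_setD1 n (S : {set 'I_n}) (a b : 'I_n) : a \in S -> b \in S ->
  lex_le (S :\ a) (S :\ b) = (b <= a).
Proof.
move=> aS bS; rewrite /lex_le; case: (ltngtP a b) => [ab|ba|/val_inj->].
- by rewrite leNgt lex_lt_setD1.
- by rewrite ltW // lex_lt_setD1.
- by rewrite lexx.
Qed.

(* Along the packet of [S], ordered as S\c, S\b, S\a for a < b < c, membership
   in [V] shows neither the pattern 0,1,0 nor the pattern 1,0,1. *)
Definition unimodal n (j : nat) (V : pred {set 'I_n}) :=
  forall (S : {set 'I_n}) (a b c : 'I_n), #|S| = j.+2 ->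
    a \in S -> b \in S -> c \in S -> a < b -> b < c ->
    V (S :\ a) = V (S :\ c) -> V (S :\ b) = V (S :\ a).

Lemma packetP n k (S A : {set 'I_n}) : #|S| = k.+2 ->
  reflect (exists2 a, a \in S & A = S :\ a) (A \in packet k S).
Proof.
move=> cS; rewrite !finset.inE; apply: (iffP andP) => [[/eqP cA AS]|[a aS ->]].
  have /cards1P[a Sa] : #|S :\: A| == 1%N by rewrite cardsD (finset.setIidPr AS) cS cA; lia.
  exists a; first by move/finset.setP/(_ a): Sa; rewrite !finset.inE eqxx => /andP[].
  apply/finset.setP => x; move/finset.setP/(_ x): Sa; rewrite !finset.inE.
  by have [xA|xA] := boolP (x \in A); rewrite /= => <-;
    rewrite ?(fintype.subsetP AS x xA) ?andNb //; case: (x \in S).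
split; last exact: finset.subD1set.
by have := cardsD1 a S; rewrite aS cS add1n => -[<-].
Qed.

(** The four cases of the definition say that membership is monotone, in one direction or the other,
    in the removed element. A two-valued sequence on a chain is monotone exactly when no three
    places show 0,1,0 or 1,0,1. *)
Lemma consistentP n k (U : {set {set 'I_n}}) : U \subset ksubsets n k.+1 ->
  reflect (unimodal k (mem U)) (consistent k U).
Proof.
move=> Uk; rewrite /consistent Uk /=.
have P (S : {set 'I_n}) a : #|S| = k.+2 -> a \in S -> S :\ a \in packet k S.
  by move=> cS aS; apply/packetP => //; exists a.
apply: (iffP forallP) => [H S a b c cS aS bS cS' ab bc /= Eac|H S].
  have := H S; rewrite {1}finset.inE cS eqxx /= =>
    /or4P[/eqP/finset.setP E|/eqP/finset.setP E|/andP[_ E]|/andP[_ E]].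
  - have F x : x \in S -> (S :\ x \in U) = false.
      by move=> xS; have := E (S :\ x); rewrite finset.in_setI P // andbT finset.in_set0.
    by rewrite !F.
  - have F x : x \in S -> (S :\ x \in U) = true.
      by move=> xS; have := E (S :\ x); rewrite finset.in_setI P // andbT.
    by rewrite !F.
  - have F x y : x \in S -> y \in S -> S :\ x \in U -> x <= y -> S :\ y \in U.
      move=> xS yS xU xy; move/forall_inP: E => /(_ (S :\ x)).
      rewrite finset.in_setI xU P // => /(_ isT)/forall_inP/(_ _ (P _ y cS yS)).
      by rewrite lex_le_setD1 // xy /= finset.in_setI => /andP[].
    apply/idP/idP => h; last by apply: (F a b) => //; apply: ltnW.
    by rewrite Eac; apply: (F b c) => //; apply: ltnW.
  - have F x y : x \in S -> y \in S -> S :\ x \in U -> y <= x -> S :\ y \in U.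
      move=> xS yS xU xy; move/forall_inP: E => /(_ (S :\ x)).
      rewrite finset.in_setI xU P // => /(_ isT)/forall_inP/(_ _ (P _ y cS yS)).
      by rewrite lex_le_setD1 // xy /= finset.in_setI => /andP[].
    apply/idP/idP => h; first by apply: (F b a) => //; apply: ltnW.
    by rewrite Eac in h; apply: (F c b) => //; apply: ltnW.
apply/implyP; rewrite finset.inE => /eqP cS.
rewrite /beginning_segment /ending_segment finset.subsetIr /=.
apply/or4P; case: (boolP [forall A in _, _]) => [_|]; first exact: Or43.
move/forall_inPn => [A]; rewrite finset.in_setI => /andP[AU AP] /forall_inPn[B BP].
rewrite negb_imply finset.in_setI BP andbT => /andP[BA BU].
apply: Or44; apply/forall_inP => A'; rewrite finset.in_setI => /andP[AU' AP'].
apply/forall_inP => B' BP'; apply/implyP => AB'; rewrite finset.in_setI BP' andbT.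
apply/negPn/negP => BU'.
case/(packetP _ cS): AP AU BA => a aS ->; case/(packetP _ cS): BP BU => b bS -> BU AU.
case/(packetP _ cS): AP' AU' AB' => a' aS' ->; case/(packetP _ cS): BP' BU' => b' bS' -> BU' AU'.
rewrite !lex_le_setD1 // => ba ab.
have D x y : S :\ x \in U -> S :\ y \notin U -> x <> y.
  by move=> ? /negP n1 exy; apply: n1; rewrite -exy.
have := D _ _ AU BU; have := D _ _ AU BU'; have := D _ _ AU' BU; have := D _ _ AU' BU'.
move=> n1 n2 n3 n4.
have {}n1 : (a' : nat) <> b' by move/val_inj. have {}n2 : (a' : nat) <> b by move/val_inj.
have {}n3 : (a : nat) <> b' by move/val_inj. have {}n4 : (a : nat) <> b by move/val_inj.
(* Both segment conditions fail, through a <= b and b' <= a' with [a], [a'] in and [b], [b'] out.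
   The triple b', a, b shows 0,1,0 if b' < a; otherwise a, b', a' shows 1,0,1. *)
case: (ltngtP b' a) => [h|h|h]; last by rewrite h in n3.
  have h2 : a < b by rewrite ltn_neqAle ab andbT; apply/eqP.
  have := H S b' a b cS bS' aS bS h h2.
  by rewrite /= AU (negPf BU) (negPf BU') => /(_ erefl).
have h2 : b' < a' by rewrite ltn_neqAle ba eq_sym andbT; apply/eqP.
have := H S a b' a' cS aS bS' aS' h h2.
by rewrite /= AU AU' (negPf BU') => /(_ erefl).
Qed.

(** * Levels and an acyclic ranking of packets *)

Definition maxelt n (A : {set 'I_n}) : nat := \max_(i in A) i.

Lemma leq_maxelt n (A : {set 'I_n}) x : x \in A -> x <= maxelt A.
Proof. by move=> xA; rewrite /maxelt (bigD1 x) //= leq_maxl. Qed.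

Lemma maxelt_leq n (A : {set 'I_n}) m :
  (forall x, x \in A -> x <= m) -> maxelt A <= m.
Proof. by move=> H; apply/bigmax_leqP. Qed.

Lemma maxelt_mem n (A : {set 'I_n}) : 0 < #|A| ->
  exists2 x, x \in A & maxelt A = x.
Proof. by case/(eq_bigmax_cond (fun i : 'I_n => i : nat)) => x xA e; exists x. Qed.

Lemma maxelt_eq n (A : {set 'I_n}) (s : 'I_n) : s \in A ->
  (forall x, x \in A -> x <= s) -> maxelt A = s.
Proof. by move=> sA H; apply/eqP; rewrite eqn_leq leq_maxelt // maxelt_leq. Qed.

Lemma maxelt_setD1_max n (A : {set 'I_n}) (s x : 'I_n) : s \in A ->
  (forall y, y \in A -> y <= s) -> x < s -> maxelt (A :\ x) = s.
Proof.
move=> sA H xs; apply: maxelt_eq => [|y]; rewrite !finset.inE.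
  by rewrite sA andbT; apply: contraTneq xs => ->; rewrite ltnn.
by case/andP=> _; apply: H.
Qed.

Lemma card_setD1 n (A : {set 'I_n}) x j : x \in A -> #|A| = j.+1 -> #|A :\ x| = j.
Proof. by move=> xA; have := cardsD1 x A; rewrite xA => -> []. Qed.

(** Only the removal of the maximum of [S] can lower the level, and neither [a] nor [b] is that
    maximum. *)
Lemma maxelt_triple n (S : {set 'I_n}) (a b c : 'I_n) :
  a \in S -> b \in S -> c \in S -> a < b -> b < c ->
  maxelt (S :\ a) = maxelt (S :\ b) /\ maxelt (S :\ c) <= maxelt (S :\ a).
Proof.
move=> aS bS cS ab bc.
have [|s sS es] := @maxelt_mem n S; first by rewrite card_gt0; apply/finset.set0Pn; exists a.
have H y : y \in S -> y <= s by rewrite -es; apply: leq_maxelt.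
have cs := H _ cS.
have as_ : a < s by lia. have bs : b < s by lia.
rewrite (maxelt_setD1_max sS H as_) (maxelt_setD1_max sS H bs); split=> //.
by apply: maxelt_leq => x; rewrite finset.inE => /andP[_]; apply: H.
Qed.

Lemma setU1D1 n (o x : 'I_n) (S : {set 'I_n}) : x != o -> (o |: S) :\ x = o |: (S :\ x).
Proof.
move=> xo; apply/finset.setP => y; rewrite !finset.inE; case: (eqVneq y o) => [->|] //=.
by rewrite eq_sym xo.
Qed.

(* [V] orders each packet lexicographically or in reverse; the union of these
   orders is acyclic. The rank lists first the sets A with A + o in V, then the
   sets containing the largest element o, then the remaining ones. *)
Lemma packet_rank n k m (V : pred {set 'I_n}) :
  (forall (S : {set 'I_n}) (a b c : 'I_n), (forall x, x \in S -> x < m) ->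
    #|S| = k.+2 -> a \in S -> b \in S -> c \in S -> a < b -> b < c ->
    V (S :\ a) = V (S :\ c) -> V (S :\ b) = V (S :\ a)) ->
  exists r : {set 'I_n} -> nat, forall (T : {set 'I_n}) (a b : 'I_n),
    (forall x, x \in T -> x < m) -> #|T| = k.+1 -> a \in T -> b \in T -> a < b ->
    if V T then r (T :\ b) < r (T :\ a) else r (T :\ a) < r (T :\ b).
Proof.
elim: m k V => [|m IHm] k V H.
  by exists (fun=> 0) => T a b /(_ a) + _ aT => /(_ aT).
have [mn|mn] := ltnP m n; last first.
  have [|r Hr] := IHm k V.
    by move=> S a b c _; apply: H => x _; apply: leq_trans (ltn_ord x) (leqW _).
  exists r => T a b _; apply: Hr => x _; exact: leq_trans (ltn_ord x) _.
case: k H => [|k] H.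
  exists (fun=> 0) => T a b _ /eqP/cards1P[x ->]; rewrite !finset.inE => /eqP-> /eqP->.
  by rewrite ltnn.
pose o := Ordinal mn.
have [|r1 H1] := IHm k.+1 V.
  by move=> S a b c Sm; apply: H => x /Sm /leqW.
have lto (x : 'I_n) : x < m -> x != o by apply: contraTneq => ->; rewrite ltnn.
have oN (S : {set 'I_n}) : (forall x, x \in S -> x < m) -> o \notin S.
  by move=> Sm; apply/negP => /Sm; rewrite ltnn.
have Uo (S : {set 'I_n}) : (forall x, x \in S -> x < m) ->
  forall x, x \in o |: S -> x < m.+1.
  by move=> Sm x; rewrite !finset.inE => /predU1P[->//|/Sm/leqW].
(* The sets containing [o], taken without [o], satisfy the hypothesis with [k] lowered by one. *)
have [|r2 H2] := IHm k (fun A => V (o |: A)).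
  move=> S a b c Sm cS aS bS cS' ab bc.
  rewrite -!setU1D1 ?lto ?Sm //; apply: H => //; first exact: Uo.
  - by rewrite cardsU1 oN // cS.
  - by rewrite !finset.inE aS orbT.
  - by rewrite !finset.inE bS orbT.
  - by rewrite !finset.inE cS' orbT.
(* [M] exceeds all values of both ranks, so the offsets 0, M and 2M keep the three blocks apart. *)
pose M := (\max_A r1 A + \max_A r2 A).+1.
have M1 A : r1 A < M by rewrite ltnS; apply: leq_trans (leq_addr _ _); exact: leq_bigmax.
have M2 (A : {set 'I_n}) : r2 A < M.
  by rewrite ltnS; apply: leq_trans (leq_addl _ _); exact: leq_bigmax.
exists (fun A : {set 'I_n} => if o \in A then M + r2 (A :\ o) else
          if V (o |: A) then r1 A else M + M + r1 A).
move=> T a b Tm cT aT bT ab.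
have [oT|oT] := boolP (o \in T); last first.
  have Tm' x : x \in T -> x < m.
    move=> xT; have := Tm x xT; rewrite ltnS leq_eqVlt => /predU1P[xo|//].
    by case/negP: oT; rewrite (_ : o = x) //; apply: val_inj.
  have := H1 T a b Tm' cT aT bT ab.
  (* In the packet of [o |: T], the removals of a, b, o cannot show 1,0,1 or 0,1,0. These are
     exactly the cases in which [T :\ a] and [T :\ b] lie in different blocks, in the wrong order
     for [V T]. *)
  have := H (o |: T) a b o (Uo _ Tm').
  rewrite cardsU1 oT cT =>
    /(_ erefl (finset.setU1r _ aT) (finset.setU1r _ bT) (finset.setU11 _ _) ab (Tm' b bT)).
  rewrite finset.setU1K // !setU1D1 ?lto ?Tm' //.
  have -> : o \in T :\ a = false by rewrite finset.inE (negPf oT) andbF.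
  have -> : o \in T :\ b = false by rewrite finset.inE (negPf oT) andbF.
  have := M1 (T :\ a); have := M1 (T :\ b).
  case: (V T); case: (V (o |: T :\ a)); case: (V (o |: T :\ b));
    try (move=> _ _ /(_ erefl) // ); lia.
have To x : x \in T -> x != o -> x < m.
  move=> /Tm; rewrite ltnS leq_eqVlt => /predU1P[xo|//].
  by case/eqP; apply: val_inj.
have ao : a != o.
  by apply: contraTneq ab => ->; rewrite -leqNgt -ltnS Tm.
rewrite !finset.inE oT !andbT !(eq_sym o) ao /=.
have [bo|bo] := eqVneq b o.
  (* [T :\ a] contains [o] and lies in the middle block, while [T :\ o] lies in the first or the
     last block according to [V T]. *)
  rewrite bo /= finset.setD1K //.
  have := M1 (T :\ o); have := M2 (T :\ a :\ o); case: (V T); lia.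
have := H2 (T :\ o) a b; rewrite finset.setD1K //.
rewrite (card_setD1 oT cT) !finset.inE ao bo aT bT ab /=.
have C x : T :\ o :\ x = T :\ x :\ o by rewrite !finset.setDDl finset.setUC.
move=> H2'; have {}H2' : if V T then r2 (T :\ o :\ b) < r2 (T :\ o :\ a)
                         else r2 (T :\ o :\ a) < r2 (T :\ o :\ b).
  by apply: H2' => // x; rewrite !finset.inE => /andP[xo xT]; apply: To.
by move: H2'; rewrite !C; case: (V T); rewrite ltn_add2l.
Qed.

(** * Comparability of consistent sets that differ at one level *)

Section BruhatOrder.
Variables n k : nat.
Implicit Types (U W : higher_bruhat n k) (A S T : {set 'I_n}).

Lemma hb_card U A : A \in val U -> #|A| = k.+1.
Proof.
case/andP: (valP U) => /fintype.subsetP + _ => /(_ A) + AU => /(_ AU).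
by rewrite finset.inE => /eqP.
Qed.

Lemma hb_unimodal U : unimodal k (mem (val U)).
Proof. by apply/consistentP; [case/andP: (valP U)|exact: valP]. Qed.

(** Among the missing sets [A], one with [A :\ o] of least rank is added first. The rank depends on
    [U] only through the sets below [o], which additions at level [o] leave alone, so one rank
    serves the whole induction. *)
Lemma hb_le_one_level U W (o : 'I_n) : val U \subset val W ->
  (forall A, A \in val W -> A \notin val U -> maxelt A = o) -> hb_le U W.
Proof.
have [r Hr] : exists r : {set 'I_n} -> nat, forall T (a b : 'I_n),
    (forall x, x \in T -> x < o) -> #|T| = k.+1 -> a \in T -> b \in T -> a < b ->
    if T \in val U then r (T :\ b) < r (T :\ a) else r (T :\ a) < r (T :\ b).
  apply: (packet_rank (V := mem (val U))) => S a b c _.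
  exact: hb_unimodal.
have [d] := ubnP #|val W :\: val U|.
elim: d U Hr => // d IHd U Hr cD sUW lev.
have [D0|/finset.set0Pn[A0 A0D]] := eqVneq (val W :\: val U) finset.set0.
  rewrite (_ : U = W) ?hb_le_refl //; apply/val_inj/eqP.
  by rewrite finset.eqEsubset sUW -finset.setD_eq0 D0 eqxx.
pose rk A := r (A :\ o).
have [A AD Amin] : exists2 A, A \in val W :\: val U &
    forall B, B \in val W :\: val U -> rk A <= rk B.
  by exists [arg min_(A < A0 in val W :\: val U) rk A]; case: arg_minnP.
have [AU AW] : A \notin val U /\ A \in val W.
  by move: AD; rewrite finset.inE => /andP.
have levA := lev _ AW AU.
pose u1 := A |: val U.
have u1E B : (B \in u1) = (B == A) || (B \in val U) by rewrite !finset.inE.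
have u1W : u1 \subset val W.
  apply/fintype.subsetP => B; rewrite u1E => /predU1P[->//|]; exact: (fintype.subsetP sUW).
have u1k : u1 \subset ksubsets n k.+1.
  apply/fintype.subsetP => B /(fintype.subsetP u1W)/hb_card; rewrite finset.inE => ->.
  exact: eqxx.
have UW B : maxelt B <> o -> (B \in val U) = (B \in val W).
  move=> Bo; apply/idP/idP; first exact: (fintype.subsetP sUW).
  by move=> BW; apply/negPn/negP => /(lev _ BW).
have uniU := @hb_unimodal U; have uniW := @hb_unimodal W.
(* In a packet with maximum [o], the membership of [S :\ o] fixes the direction in which the other
   memberships are monotone, for [U] and [W] alike. The set [u1] respects it because [A] has least
   rank. *)
have implo S a b : #|S| = k.+2 -> o \in S -> (forall x, x \in S -> x <= o) ->
    a \in S -> b \in S -> a < b -> b < o ->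
    if S :\ o \in val U then S :\ a \in u1 -> S :\ b \in u1
    else S :\ b \in u1 -> S :\ a \in u1.
  move=> cS oS om aS bS ab bo.
  have To x : x \in S :\ o -> x < o.
    rewrite !finset.inE => /andP[xo xS]; rewrite ltn_neqAle om // andbT.
    by apply: contraNneq xo => /val_inj->.
  have ao : a < o := ltn_trans ab bo.
  have aT : a \in S :\ o.
    by rewrite !finset.inE aS andbT; apply: contraTneq ao => ->; rewrite ltnn.
  have bT : b \in S :\ o.
    by rewrite !finset.inE bS andbT; apply: contraTneq bo => ->; rewrite ltnn.
  have C x : S :\ o :\ x = S :\ x :\ o by rewrite !finset.setDDl finset.setUC.
  have := Hr (S :\ o) a b To (card_setD1 oS cS) aT bT ab; rewrite !C.
  have := uniW S a b o cS aS bS oS ab bo.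
  have := uniU S a b o cS aS bS oS ab bo.
  have To' : maxelt (S :\ o) <> o.
    have [|y /To yo ->] := @maxelt_mem _ (S :\ o); last by move=> e; rewrite e ltnn in yo.
    by rewrite card_gt0; apply/finset.set0Pn; exists a.
  rewrite /= -(UW _ To') !u1E -/(rk (S :\ a)) -/(rk (S :\ b)).
  have sa := fintype.subsetP sUW (S :\ a). have sb := fintype.subsetP sUW (S :\ b).
  have ma := Amin (S :\ a). have mb := Amin (S :\ b).
  rewrite !finset.inE in ma mb.
  case: (S :\ o \in val U) => h1 h2 h3.
  - case/predU1P => [ea|ua]; last first.
      by rewrite h1 ?ua ?orbT.
    rewrite -ea in AU AW; rewrite AW in h2; rewrite (h2 erefl) in mb.
    case: (S :\ b \in val U) mb => [|/= /(_ isT)]; first by rewrite orbT.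
    by rewrite -ea leqNgt h3.
  - case/predU1P => [eb|ub]; last first.
      apply/orP; right; apply/negPn/negP => ua; move: h1.
      by rewrite (negPf ua) ub => /(_ erefl).
    rewrite -eb in AU AW; rewrite AW in h2.
    case aU: (S :\ a \in val U); first by rewrite orbT.
    case aW: (S :\ a \in val W) h2; last by move=> /(_ erefl).
    move: ma; rewrite aU aW => /(_ isT).
    by rewrite -eb leqNgt h3.
have con1 : consistent k u1.
  apply/consistentP => // S a b c cS aS bS cS' ab bc /=.
  have [sab sc] := maxelt_triple aS bS cS' ab bc.
  have [so|so] := eqVneq (maxelt (S :\ a)) (o : nat); last first.
    have na : S :\ a <> A by move=> e; rewrite e levA eqxx in so.
    have nb : S :\ b <> A by move=> e; rewrite sab e levA eqxx in so.
    have va : (S :\ a \in u1) = (S :\ a \in val U).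
      by rewrite u1E; case: eqP.
    have vb : (S :\ b \in u1) = (S :\ b \in val U).
      by rewrite u1E; case: eqP.
    (* Only [S :\ c] can be the new set; then the unimodality of [W] applies, since [U] and [W]
       agree on the other two. *)
    rewrite va vb u1E; case: eqP => [ec|_]; last exact: uniU.
    rewrite (UW (S :\ a)); last exact/eqP.
    rewrite (UW (S :\ b)); last by rewrite -sab; apply/eqP.
    by have := uniW S a b c cS aS bS cS' ab bc; rewrite /= ec AW.
  have oSa : o \in S :\ a.
    have [|y yS ey] := @maxelt_mem _ (S :\ a).
      by rewrite (card_setD1 aS cS).
    by rewrite (_ : o = y) //; apply: val_inj; rewrite /= -ey.
  have oS : o \in S by move: oSa; rewrite !finset.inE => /andP[].
  have So x : x \in S -> x <= o.
    move=> xS; have [->|xa] := eqVneq x a.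
      rewrite -so; apply: leq_trans (ltnW (ltn_trans ab bc)) (leq_maxelt _).
      by rewrite !finset.inE cS' andbT; apply: contraTneq (ltn_trans ab bc) => ->; rewrite ltnn.
    by rewrite -so; apply: leq_maxelt; rewrite !finset.inE xa.
  have := So _ cS'; rewrite leq_eqVlt => /predU1P[co|co].
    have {}co : c = o by apply: val_inj.
    have := implo S a b cS oS So aS bS ab.
    rewrite co in bc * => /(_ bc).
    have -> : (S :\ o \in u1) = (S :\ o \in val U).
      rewrite u1E; case: eqP => //= e; move: levA; rewrite -e => levo.
      have [|y] := @maxelt_mem _ (S :\ o); first by rewrite (card_setD1 oS cS).
      rewrite levo !finset.inE => /andP[/eqP yo _] /val_inj oy; by case: yo.
    case: (S :\ o \in val U) => h e; move: h; rewrite e.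
      by apply.
    by case: (S :\ b \in u1) => // /(_ isT).
  (* All three removed elements lie below [o], and membership in [u1] is monotone along them. *)
  have bo := ltn_trans bc co; have ac := ltn_trans ab bc.
  have := implo S a b cS oS So aS bS ab bo.
  have := implo S a c cS oS So aS cS' ac co.
  have := implo S b c cS oS So bS cS' bc co.
  case: (S :\ o \in val U); case: (S :\ a \in u1); case: (S :\ b \in u1);
    case: (S :\ c \in u1) => //; by [move=> _ _ /(_ isT)|move=> /(_ isT)].
pose U1 : higher_bruhat n k := Sub u1 con1.
have D1 : val W :\: u1 = (val W :\: val U) :\ A.
  by apply/finset.setP => B; rewrite !finset.inE negb_or andbA.
apply: (@hb_le_trans _ _ U1).
  apply: connect1; rewrite /single_step /= finset.subsetUr /=.
  rewrite -(cards1 A); apply/eqP; congr #|pred_of_set _|; apply/finset.setP => B.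
  by rewrite !finset.inE; case: eqP => [->|]; rewrite ?AU //= andNb.
apply: IHd => //=.
(* The set [A] has maximum [o], so it is none of the sets [T] below [o], and the rank stays valid
   for [u1]. *)
- move=> T a b Tm cT aT bT ab; have := Hr T a b Tm cT aT bT ab.
  rewrite u1E; case: eqP => // TA; move: levA; rewrite -TA => levT.
  have [|y yT] := @maxelt_mem _ T; first by rewrite cT.
  by rewrite levT => e; have := Tm y yT; rewrite e ltnn.
- by rewrite D1; move: cD; rewrite (cardsD1 A) AD.
- by move=> B BW; rewrite u1E negb_or => /andP[_]; apply: lev.
Qed.

Lemma hb_le_level U W (s : nat) : val U \subset val W ->
  (forall A, A \in val W -> A \notin val U -> maxelt A = s) -> hb_le U W.
Proof.
move=> sUW lev.
have [D0|/finset.set0Pn[A]] := eqVneq (val W :\: val U) finset.set0.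
  rewrite (_ : U = W) ?hb_le_refl //; apply/val_inj/eqP.
  by rewrite finset.eqEsubset sUW -finset.setD_eq0 D0 eqxx.
rewrite finset.inE => /andP[AU AW]; have [|o _ eo] := @maxelt_mem _ A.
  by rewrite (hb_card AW).
apply: (@hb_le_one_level _ _ o) => // B BW BU.
by rewrite -eo (lev _ AW AU) lev.
Qed.

End BruhatOrder.

(** * Endomorphisms that make levels constant *)

Section LevelMaps.
Variables n k : nat.
Implicit Types (U W : higher_bruhat n k) (A S T : {set 'I_n}).

Lemma maxelt_ltn A : 0 < #|A| -> maxelt A < n.
Proof. by case/maxelt_mem => x _ ->. Qed.

Lemma maxelt_geq A : #|A| = k.+1 -> k <= maxelt A.
Proof.
move=> cA; rewrite -ltnS -cA -[X in _ <= X]card_ord.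
have inj : {in A &, injective (fun x : 'I_n => inord x : 'I_(maxelt A).+1)}.
  move=> x y xA yA /(congr1 val); rewrite /= !inordK ?ltnS ?leq_maxelt //.
  exact: val_inj.
by rewrite -(card_in_imset inj) max_card.
Qed.

(** The subtraction is truncated; the set has k+1 elements when k <= s < n, and these are the levels
    at which (k+1)-sets occur. *)
Definition topset (s : nat) : {set 'I_n} := [set x : 'I_n | s - k <= x <= s].

Lemma maxelt_topset s : s < n -> maxelt (topset s) = s.
Proof.
move=> sn; apply: (@maxelt_eq _ _ (Ordinal sn)).
  by rewrite finset.inE /= leqnn leq_subr.
by move=> x; rewrite finset.inE => /andP[].
Qed.

Lemma card_topset s : k <= s -> s < n -> #|topset s| = k.+1.
Proof.
move=> ks sn; have lt (i : 'I_k.+1) : s - k + i < n by case: i => i /= hi; lia.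
have -> : topset s = [set Ordinal (lt i) | i in 'I_k.+1].
  apply/finset.setP => x; rewrite finset.inE; apply/idP/imsetP => [/andP[h1 h2]|[i _ ->]].
    have h : x - (s - k) < k.+1 by lia.
    by exists (Ordinal h) => //; apply: val_inj => /=; lia.
  by case: i => i hi /=; lia.
rewrite card_imset ?card_ord // => x y /(congr1 val) /= /eqP.
by rewrite eqn_add2l => /eqP; apply: val_inj.
Qed.

(** The sets [S :\ a] and [S :\ b] have a common level, not below that of [S :\ c]. Either [W] is
    constant there, so that these two agree, or [W] agrees with [V] on all three. *)
Lemma consistent_levels (V W : {set {set 'I_n}}) :
  unimodal k (mem V) -> W \subset ksubsets n k.+1 ->
  (forall s, (exists c, forall A, #|A| = k.+1 -> maxelt A = s -> (A \in W) = c) \/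
     (forall A, #|A| = k.+1 -> maxelt A <= s -> (A \in W) = (A \in V))) ->
  consistent k W.
Proof.
move=> uV sW H; apply/consistentP => // S a b c cS aS bS cS' ab bc /=.
have [sab sc] := maxelt_triple aS bS cS' ab bc.
have cD x : x \in S -> #|S :\ x| = k.+1 by move=> xS; apply: card_setD1.
case: (H (maxelt (S :\ a))) => [[e he] _|h].
  by rewrite !he ?cD.
rewrite !h ?cD // -?sab //; exact: uV.
Qed.

(** The boolean counts as 0 or 1. For [b = true] the two clauses overlap at level [j], which is
    filled if its top set is in [U] and left as in [U] otherwise. *)
Definition level_map_set (b : bool) (j : nat) (U : {set {set 'I_n}}) :=
  [set A in ksubsets n k.+1 | (maxelt A < b + j) && (A \in U)
                             || (j <= maxelt A) && (topset (maxelt A) \in U)].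

Lemma in_level_map_set b j (V : {set {set 'I_n}}) A : #|A| = k.+1 ->
  (A \in level_map_set b j V) = (maxelt A < b + j) && (A \in V)
    || (j <= maxelt A) && (topset (maxelt A) \in V).
Proof. by move=> cA; rewrite !finset.inE cA eqxx. Qed.

Lemma level_map_consistent b j U : consistent k (level_map_set b j (val U)).
Proof.
apply: (@consistent_levels (val U)); first exact: hb_unimodal.
  by apply/fintype.subsetP => A; rewrite finset.inE => /andP[].
move=> s; have [sj|js] := ltnP s j.
  right=> A cA As; rewrite in_level_map_set //.
  have Aj := leq_ltn_trans As sj.
  by rewrite (leq_trans Aj (leq_addl _ _)) (leqNgt j) Aj orbF.
have [bs|sb] := leqP (b + j) s; last first.
  (* Here [b] is true and [s = j], the level of overlap. *)
  case ts: (topset s \in val U).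
    by left; exists true => A cA As; rewrite in_level_map_set // As js ts orbT.
  right=> A cA As; rewrite in_level_map_set //.
  rewrite (leq_ltn_trans As sb) /=.
  have [jA|_] := leqP j (maxelt A); last by rewrite orbF.
  rewrite (_ : maxelt A = s) ?ts ?orbF //.
  by case: b sb As jA js => /=; clear; lia.
left; exists (topset s \in val U) => A cA As; rewrite in_level_map_set //.
by rewrite As js ltnNge bs.
Qed.

(* [level_map true j] is a common upper bound of [level_map false j] and
   [level_map false j.+1]. *)
Definition level_map b j U : higher_bruhat n k := Sub _ (level_map_consistent b j U).

(** A single step adds one set [A] and changes the image at the level of [A] only; the images are
    then comparable, though possibly by many steps. *)
Lemma level_map_homo b j U W : hb_le U W -> hb_le (level_map b j U) (level_map b j W).
Proof.
case/connectP => p; elim: p U => [|V p IHp] U /=; first by move=> _ ->; apply: hb_le_refl.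
case/andP=> /andP[sUV /cards1P[A VA]] pV eW; apply: hb_le_trans (IHp _ pV eW).
apply: (@hb_le_level _ _ _ _ (maxelt A)) => [|B].
  apply/fintype.subsetP => B; rewrite !finset.inE => /andP[-> /=].
  by case/orP => /andP[-> h]; apply/orP; [left|right]; exact: (fintype.subsetP sUV).
rewrite !finset.inE => /andP[cB] h; rewrite cB /= negb_or.
have D C : C \in val V -> C \notin val U -> C = A.
  by move=> CV CU; apply/finset.set1P; rewrite -VA finset.inE CU.
case/orP: h => /andP[-> h] /= /andP[h1 h2].
  by rewrite (D B).
rewrite -(D _ h h2) maxelt_topset // maxelt_ltn //.
by move/eqP: cB => ->.
Qed.

Lemma level_map_false_true j U : hb_le (level_map false j U) (level_map true j U).
Proof.
apply: (@hb_le_level _ _ _ _ j) => [|A].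
  apply/fintype.subsetP => A; rewrite !finset.inE => /andP[-> /=].
  by case/orP => /andP[h ->]; rewrite ?andbT ?h ?orbT //= ltnW.
rewrite !finset.inE => /andP[-> /=]; move: (maxelt A) => s.
by case: (A \in val U); case: (topset _ \in val U); rewrite ?andbT ?andbF ?orbF //=; clear; lia.
Qed.

Lemma level_mapS_false_true j U : hb_le (level_map false j.+1 U) (level_map true j U).
Proof.
apply: (@hb_le_level _ _ _ _ j) => [|A].
  apply/fintype.subsetP => A; rewrite !finset.inE => /andP[-> /=].
  by case/orP => /andP[h ->]; rewrite ?andbT ?h ?orbT //= (ltnW h) orbT.
rewrite !finset.inE => /andP[-> /=]; move: (maxelt A) => s.
by case: (A \in val U); case: (topset _ \in val U); rewrite ?andbT ?andbF ?orbF //=; clear; lia.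
Qed.

Lemma level_map_id U : level_map false n U = U.
Proof.
apply/val_inj/finset.setP => A; rewrite /= !finset.inE -[false + n]/n.
apply/andP/idP => [[/eqP cA]|AU].
  by rewrite (leqNgt n) maxelt_ltn ?cA //= orbF.
by rewrite AU (hb_card AU) maxelt_ltn ?(hb_card AU) ?eqxx.
Qed.

(* A set [A] of maximum [s] distinct from [topset s] lies in a packet between
   a set of smaller maximum and a set of maximum [s] closer to [topset s]. *)
Lemma hb_constant U c m :
  (forall A, #|A| = k.+1 -> maxelt A < m -> (A \in val U) = c) ->
  (forall s, m <= s -> k <= s -> s < n -> (topset s \in val U) = c) ->
  forall A, #|A| = k.+1 -> (A \in val U) = c.
Proof.
move=> Hm Ht A; have [s] := ubnP (maxelt A); elim: s A => // s IHs A As cA.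
have [Am|mA] := ltnP (maxelt A) m; first exact: Hm.
have {}IHs B : maxelt B < maxelt A -> #|B| = k.+1 -> (B \in val U) = c.
  by move=> BA; apply: IHs; apply: leq_trans BA _; rewrite -ltnS.
have An : maxelt A < n by rewrite maxelt_ltn ?cA.
have kA := maxelt_geq cA.
have {s As} [s e] : {s | maxelt A = s} by exists (maxelt A).
rewrite e in mA IHs An kA; move: e mA IHs An kA.
have [d] := ubnP #|A :\: topset s|.
elim: d A cA => // d IHd A cA Ad As ms IHs sn ks.
have ct := card_topset ks sn.
have [D0|/finset.set0Pn[a]] := eqVneq (A :\: topset s) finset.set0.
  rewrite (_ : A = topset s) ?Ht //; apply/eqP.
  by rewrite eqEcard -finset.setD_eq0 D0 eqxx cA ct leqnn.
rewrite finset.inE => /andP[aT aA].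
have /fintype.subsetPn[i iT iA] : ~~ (topset s \subset A).
  by apply: contra aT => tA; have /eqP -> : topset s == A by rewrite eqEcard tA cA ct leqnn.
have [|s' sA es] := @maxelt_mem _ A; first by rewrite cA.
rewrite As in es; have leA x : x \in A -> x <= s by rewrite -As; apply: leq_maxelt.
have iS : i < s'.
  rewrite ltn_neqAle -es; move: iT; rewrite finset.inE => /andP[_ ->]; rewrite andbT.
  by rewrite es; apply: contraNneq iA => /val_inj->.
have ai : a < i.
  move: iT aT; rewrite !finset.inE (leA a aA) andbT -ltnNge => /andP[h _] h'.
  exact: leq_trans h' h.
(* Since a < i < s', the set [A] is the middle one of the removals of a, i, s' from [S]. *)
pose S := i |: A.
have cS : #|S| = k.+2 by rewrite cardsU1 iA cA.
have [aS iS' sS] : [/\ a \in S, i \in S & s' \in S].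
  by rewrite !finset.inE aA sA eqxx !orbT.
have IHa : (S :\ a \in val U) = c.
  apply: IHd => //.
  - exact: card_setD1.
  - rewrite -ltnS; apply: leq_trans Ad.
    rewrite ltnS (cardsD1 a (A :\: _)) finset.in_setD aA aT add1n ltnS.
    apply: subset_leq_card; apply/fintype.subsetP => x.
    rewrite !(finset.in_setD, finset.in_setD1) finset.in_setU1.
    case/and3P => xT -> /predU1P[xi|->]; last by rewrite xT.
    by rewrite xi iT in xT.
  - rewrite es; apply: maxelt_setD1_max => //; last exact: ltn_trans ai iS.
    by move=> y; rewrite !finset.inE -es => /predU1P[->|/leA//]; rewrite es ltnW.
have IHc : (S :\ s' \in val U) = c.
  apply: IHs; last exact: card_setD1.
  have [|y] := @maxelt_mem _ (S :\ s'); first by rewrite (card_setD1 sS cS).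
  rewrite !finset.inE => /andP[ys yS] ->; rewrite es ltn_neqAle.
  case/predU1P: yS => [->|yA]; first by rewrite (ltnW iS) neq_ltn iS.
  by rewrite -es leA // es andbT; apply: contraNneq ys => /val_inj->.
have := hb_unimodal cS aS iS' sS ai iS; rewrite /= finset.setU1K // => -> //.
by rewrite IHa IHc.
Qed.

(** The map changes neither the sets below level [j] nor the top sets of the levels from [j] on, and
    by [hb_constant] these detect constancy. *)
Lemma level_map_constant b j U c :
  (forall A, #|A| = k.+1 -> (A \in val (level_map b j U)) = c) ->
  forall A, #|A| = k.+1 -> (A \in val U) = c.
Proof.
move=> H; apply: (@hb_constant U c j) => [A cA Aj|s js ks sn].
  rewrite -(H A cA) in_level_map_set // (leqNgt j) Aj orbF.
  by rewrite (leq_trans Aj (leq_addl _ _)).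
have ct := card_topset ks sn.
rewrite -(H _ ct) in_level_map_set // maxelt_topset // js.
by case: (topset s \in _); rewrite ?andbF ?orbT.
Qed.

Definition hb_proper U := (val U != finset.set0) && (val U != ksubsets n k.+1).

(** Avoiding both bounds means that membership is not constant on (k+1)-sets; the value [c] treats
    the two bounds at once. *)
Lemma hb_properP U :
  reflect (forall c, ~ forall A, #|A| = k.+1 -> (A \in val U) = c) (hb_proper U).
Proof.
apply: (iffP andP) => [[/finset.set0Pn[A AU] UT]|H].
  case=> H; last by move: (AU); rewrite H // (hb_card AU).
  case/eqP: UT; apply/finset.setP => B; rewrite finset.inE.
  by apply/idP/eqP => [/hb_card//|cB]; rewrite H.
split; apply/eqP => UE.
  by case: (H false) => A _; rewrite UE finset.inE.
by case: (H true) => A cA; rewrite UE finset.inE cA eqxx.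
Qed.

Lemma level_map_proper b j U : hb_proper U -> hb_proper (level_map b j U).
Proof.
move=> /hb_properP H; apply/hb_properP => c Hc; apply: (H c).
exact: level_map_constant Hc.
Qed.

End LevelMaps.

(** * The Boolean lattice of sets of levels and the retraction onto it *)

Definition boolean_proper (N : nat) : Type :=
  {S : {set 'I_N} | (S != finset.set0) && (S != [set: 'I_N])}.

HB.instance Definition _ N := SubFinite.on (boolean_proper N).

Definition boolean_le N : rel (boolean_proper N) := fun S T => val S \subset val T.

Lemma boolean_le_refl N : reflexive (@boolean_le N).
Proof. by move=> S; apply: fintype.subxx. Qed.

Lemma boolean_le_anti N : antisymmetric (@boolean_le N).
Proof. by move=> S T ST; apply/val_inj/eqP; rewrite finset.eqEsubset. Qed.

Lemma boolean_le_trans N : transitive (@boolean_le N).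
Proof. by move=> T S V; apply: fintype.subset_trans. Qed.

HB.instance Definition _ N :=
  Order.Le_isPOrder.Build Order.default_display (boolean_proper N)
    (@boolean_le_refl N) (@boolean_le_anti N) (@boolean_le_trans N).

Lemma boolean_leE N (S T : boolean_proper N) : (S <= T)%O = (val S \subset val T).
Proof. by []. Qed.

Lemma proper_leE n k (x y : proper_part n k) : (x <= y)%O = hb_le (val x) (val y).
Proof. by []. Qed.

Section Retraction.
Variables n k N : nat.
Hypothesis nE : n = k + N.
Implicit Types (U W : higher_bruhat n k) (A : {set 'I_n}) (S T : {set 'I_N}).

(** The index [i] stands for the level [k + i], as [k] is the least possible maximum of a
    (k+1)-set. *)
Definition top_levels U : {set 'I_N} := [set i : 'I_N | topset n k (k + i) \in val U].

Definition fill_levels_set S : {set {set 'I_n}} :=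
  [set A in ksubsets n k.+1 | [exists i in S, maxelt A == k + i]].

Lemma fill_levels_consistent S : consistent k (fill_levels_set S).
Proof.
apply: (@consistent_levels _ _ finset.set0) => [|//|s].
- by move=> ? ? ? ? ? ? ? ? ? ? /=; rewrite !finset.inE.
- by apply/fintype.subsetP => A; rewrite finset.inE => /andP[].
left; exists [exists i in S, s == k + i] => A cA <-.
by rewrite !finset.inE cA eqxx.
Qed.

Definition fill_levels S : higher_bruhat n k := Sub _ (fill_levels_consistent S).

Lemma lt_level (i : 'I_N) : k + i < n. Proof. by rewrite nE ltn_add2l. Qed.

Lemma fill_levelsK S : top_levels (fill_levels S) = S.
Proof.
apply/finset.setP => i; rewrite finset.inE /= finset.inE finset.inE.
have iN := lt_level i.
rewrite card_topset ?leq_addr // eqxx /= maxelt_topset //.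
apply/existsP/idP => [[j /andP[jS]]|iS]; last by exists i; rewrite iS eqxx.
by rewrite eqn_add2l => /eqP/val_inj->.
Qed.

Lemma top_levelsK U : fill_levels (top_levels U) = level_map false 0 U.
Proof.
apply/val_inj/finset.setP => A; rewrite /= !finset.inE ltn0 /=.
have [cA|//] := eqVneq #|A| k.+1.
have kA := maxelt_geq cA; have An : maxelt A < n by rewrite maxelt_ltn ?cA.
apply/existsP/idP => [[i]|AU]; first by rewrite finset.inE => /andP[+ /eqP->].
have iN : maxelt A - k < N by rewrite -(ltn_add2l k) subnKC // -nE.
by exists (Ordinal iN); rewrite finset.inE /= subnKC // eqxx andbT.
Qed.

(** The levels of [T] are added one at a time, each addition being a comparison at a single
    level. *)
Lemma fill_levels_homo S T : S \subset T -> hb_le (fill_levels S) (fill_levels T).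
Proof.
have [d] := ubnP #|T :\: S|; elim: d S => // d IHd S cd ST.
have [D0|/finset.set0Pn[i]] := eqVneq (T :\: S) finset.set0.
  rewrite (_ : S = T) ?hb_le_refl //; apply/eqP.
  by rewrite finset.eqEsubset ST -finset.setD_eq0 D0 eqxx.
move=> iD; have := iD; rewrite finset.inE => /andP[iS iT].
have iST : i |: S \subset T by rewrite finset.subUset finset.sub1set iT.
apply: hb_le_trans (IHd _ _ iST); last first.
  have -> : T :\: (i |: S) = (T :\: S) :\ i.
    by apply/finset.setP => x; rewrite !finset.inE negb_or andbA.
  by move: cd; rewrite (cardsD1 i) iD.
apply: (@hb_le_level _ _ _ _ (k + i)) => [|A].
  apply/fintype.subsetP => A; rewrite !finset.inE => /andP[-> /existsP[j /andP[jS e]]].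
  by apply/existsP; exists j; rewrite !finset.inE jS orbT.
rewrite !finset.inE => /andP[-> /existsP[j /andP[+ /eqP->]]].
rewrite !finset.inE => /predU1P[->//|jS] /=.
by case/existsP; exists j; rewrite jS eqxx.
Qed.

Lemma top_levels_homo U W : hb_le U W -> top_levels U \subset top_levels W.
Proof.
move/hb_le_sub/fintype.subsetP => UW; apply/fintype.subsetP => i.
by rewrite !finset.inE; apply: UW.
Qed.

Lemma top_levels_proper U : hb_proper U ->
  (top_levels U != finset.set0) && (top_levels U != [set: 'I_N]).
Proof.
move/hb_properP => H.
have {}H c : ~ forall i : 'I_N, (i \in top_levels U) = c.
  (* With the bound [m = 0] no lower levels have to be checked, so the top sets alone decide. *)
  move=> Hc; apply: (H c); apply: (@hb_constant _ _ U c 0) => // s _ ks sn.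
  have iN : s - k < N by rewrite -(ltn_add2l k) subnKC // -nE.
  by rewrite -(Hc (Ordinal iN)) finset.inE /= subnKC.
apply/andP; split; apply/eqP => E.
  by apply: (H false) => i; rewrite E finset.inE.
by apply: (H true) => i; rewrite E finset.inE.
Qed.

Lemma fill_levels_proper S : (S != finset.set0) && (S != [set: 'I_N]) ->
  hb_proper (fill_levels S).
Proof.
move=> pS; apply/hb_properP => c H.
have {}H i : (i \in S) = c.
  have iN := lt_level i.
  by rewrite -(fill_levelsK S) finset.inE H // card_topset // leq_addr.
case/andP: pS => /finset.set0Pn[i]; rewrite H => ct /eqP; apply.
by apply/finset.setP => j; rewrite H ct finset.inE.
Qed.

Definition proper_top (x : proper_part n k) : boolean_proper N :=
  Sub (top_levels (val x)) (top_levels_proper (valP x)).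

Definition proper_fill (S : boolean_proper N) : proper_part n k :=
  Sub (fill_levels (val S)) (fill_levels_proper (valP S)).

Definition proper_level b j (x : proper_part n k) : proper_part n k :=
  Sub (level_map b j (val x)) (level_map_proper b j (valP x)).

Lemma proper_top_homo : {homo proper_top : x y / (x <= y)%O}.
Proof. by move=> x y; rewrite proper_leE boolean_leE => /top_levels_homo. Qed.

Lemma proper_fill_homo : {homo proper_fill : x y / (x <= y)%O}.
Proof. by move=> x y; rewrite proper_leE boolean_leE => /fill_levels_homo. Qed.

Lemma proper_level_homo b j : {homo proper_level b j : x y / (x <= y)%O}.
Proof. by move=> x y; rewrite !proper_leE => /(level_map_homo b j). Qed.

Lemma proper_fillK : cancel proper_fill proper_top.
Proof. by move=> S; apply/val_inj/fill_levelsK. Qed.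

Lemma proper_topK x : proper_fill (proper_top x) = proper_level false 0 x.
Proof. by apply/val_inj/top_levelsK. Qed.

Lemma proper_level_id x : proper_level false n x = x.
Proof. by apply/val_inj/level_map_id. Qed.

Lemma proper_level_false_true j x : (proper_level false j x <= proper_level true j x)%O.
Proof. by rewrite proper_leE level_map_false_true. Qed.

Lemma proper_levelS_false_true j x :
  (proper_level false j.+1 x <= proper_level true j x)%O.
Proof. by rewrite proper_leE level_mapS_false_true. Qed.

End Retraction.

(** * Realizations of order complexes *)

Section Topology.
Local Open Scope classical_set_scope.
Local Open Scope ring_scope.

(** * Continuity of real functions and of maps into subspaces and products *)

Section RealValuedContinuity.
Context {R : realType} {T : topologicalType}.
Implicit Types f g : T -> R.

Lemma cts_cst (a : R) : continuous (fun _ : T => a).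
Proof. by move=> x; exact: cvg_cst. Qed.

Lemma cts_add f g : continuous f -> continuous g -> continuous (fun x => f x + g x).
Proof. by move=> cf cg x; apply: cvgD; [exact: cf|exact: cg]. Qed.

Lemma cts_sub f g : continuous f -> continuous g -> continuous (fun x => f x - g x).
Proof. by move=> cf cg x; apply: cvgB; [exact: cf|exact: cg]. Qed.

Lemma cts_mul f g : continuous f -> continuous g -> continuous (fun x => f x * g x).
Proof. by move=> cf cg x; apply: cvgM; [exact: cf|exact: cg]. Qed.

Lemma cts_norm f : continuous f -> continuous (fun x => `|f x|).
Proof. by move=> cf x; apply: cvg_norm; exact: cf. Qed.

Lemma cts_div f g : (forall x, g x != 0) -> continuous f -> continuous g ->
  continuous (fun x => f x / g x).
Proof.
by move=> g0 cf cg; apply: cts_mul => // x; apply: cvgV => //; exact: cg.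
Qed.

Lemma cts_min f g : continuous f -> continuous g ->
  continuous (fun x => Num.min (f x) (g x)).
Proof. by move=> cf cg x; apply: continuous_min; [exact: cf|exact: cg]. Qed.

Lemma cts_max f g : continuous f -> continuous g ->
  continuous (fun x => Num.max (f x) (g x)).
Proof. by move=> cf cg x; apply: continuous_max; [exact: cf|exact: cg]. Qed.

Lemma cts_sum (I : Type) (r : seq I) (P : pred I) (F : I -> T -> R) :
  (forall i, continuous (F i)) -> continuous (fun x => \sum_(i <- r | P i) F i x).
Proof.
move=> cF; elim: r => [|i r IHr].
  rewrite (_ : (fun _ => _) = cst 0); first exact: cts_cst.
  by apply/funext => x; rewrite big_nil.
rewrite (_ : (fun _ => _) = (fun x => (if P i then F i x else 0) + \sum_(j <- r | P j) F j x)).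
  by apply: cts_add => //; case: (P i) => // x; exact: cvg_cst.
by apply/funext => x; rewrite big_cons; case: (P i); rewrite ?add0r.
Qed.

Lemma cts_bigmin (I : Type) (r : seq I) (P : pred I) (F : I -> T -> R) (D : T -> R) :
  continuous D -> (forall i, continuous (F i)) ->
  continuous (fun x => \big[Num.min/D x]_(i <- r | P i) F i x).
Proof.
move=> cD cF; elim: r => [|i r IHr].
  by rewrite (_ : (fun _ => _) = D) //; apply/funext => x; rewrite big_nil.
rewrite (_ : (fun _ => _) = (if P i then fun x => Num.min (F i x)
   (\big[Num.min/D x]_(j <- r | P j) F j x)
   else fun x => \big[Num.min/D x]_(j <- r | P j) F j x)).
  by case: (P i) => //; apply: cts_min.
by case Pi: (P i); apply/funext => x; rewrite big_cons Pi.
Qed.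

End RealValuedContinuity.

Section ContinuityInto.
Context {R : realType}.

Lemma cts_set_type (T U : topologicalType) (A : set U) (f : T -> set_type A) :
  continuous (set_val \o f) -> continuous f.
Proof. exact: continuous_comp_initial. Qed.

Lemma cts_set_val (U : topologicalType) (A : set U) :
  continuous (set_val : set_type A -> U).
Proof. exact: initial_continuous. Qed.

Lemma cts_ptws (T : topologicalType) (V : finType) (f : T -> {ptws V -> R}) :
  (forall v, continuous (fun t => f t v)) -> continuous f.
Proof.
move=> cf t; apply/cvg_sup => v U [? /= [[W oW <-]]] /= Wf /filterS; apply.
by apply: cf; exact: open_nbhs_nbhs.
Qed.

Lemma cts_ptws_proj (V : finType) (v : V) : continuous (fun x : {ptws V -> R} => x v).
Proof. exact: proj_continuous. Qed.

Lemma cts_rV (T : topologicalType) d (f : T -> 'rV[R]_d) :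
  (forall j, continuous (fun t => f t 0 j)) -> continuous f.
Proof.
move=> cf t A [P nP sPA].
have : \forall s \near t, forall j, P 0 j (f s 0 j).
  apply: filter_forall => j.
  exact: (cf j t _ (nP 0 j)).
by apply: filterS => s Ps; apply: sPA => i j; rewrite (ord1 i).
Qed.

End ContinuityInto.

(** * Homotopies with parameter in the whole line *)

Section GlobalHomotopy.
Variables (R : realType) (X Y : topologicalType).
Implicit Types f g h : X -> Y.

(** With the parameter in all of [R], reversal and gluing deal with plainly continuous maps;
    restriction to the unit interval gives [homotopic]. *)
Definition ghomotopic f g := exists H : R * X -> Y,
  [/\ continuous H, forall x, H (0, x) = f x & forall x, H (1, x) = g x].

Lemma ghomotopicW f g : ghomotopic f g -> homotopic R f g.
Proof. by case=> H [cH H0 H1]; exists H; split => //; apply: continuous_subspaceT. Qed.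

Lemma ghomotopic_eq f g : continuous f -> f =1 g -> ghomotopic f g.
Proof.
move=> cf fg; exists (f \o snd); split => // p.
by apply: continuous_comp; [exact: cvg_snd|exact: cf].
Qed.

Lemma ghomotopic_reparam (c : R -> R) (H : R * X -> Y) :
  continuous c -> continuous H -> continuous (fun p : R * X => H (c p.1, p.2)).
Proof.
move=> cc cH p; apply: (@continuous_comp _ _ _ (fun p : R * X => (c p.1, p.2))); last exact: cH.
apply: (@cvg_pair _ _ _ _ (nbhs (c p.1)) (nbhs p.2)) => //; last exact: cvg_snd.
by apply: continuous_comp; [exact: cvg_fst|exact: cc].
Qed.

Lemma ghomotopic_sym f g : ghomotopic f g -> ghomotopic g f.
Proof.
case=> H [cH H0 H1]; exists (fun p => H (1 - p.1, p.2)); split => [|x|x] /=.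
- apply: (ghomotopic_reparam (c := fun t => 1 - t)) => //.
  by apply: cts_sub => t; [exact: cvg_cst|exact: cvg_id].
- by rewrite subr0.
- by rewrite subrr.
Qed.

Lemma ghomotopic_trans f g h : ghomotopic f g -> ghomotopic g h -> ghomotopic f h.
Proof.
case=> H [cH H0 H1] [K [cK K0 K1]].
pose G (p : R * X) := if p.1 <= 2^-1 then H (2 * p.1, p.2) else K (2 * p.1 - 1, p.2).
exists G; split; last 2 first.
- by move=> x; rewrite /G /= ifT ?mulr0 //; lra.
- move=> x; rewrite /G /= ifF ?mulr1; [rewrite (_ : 2 - 1 = 1) //; lra|].
  by apply/negbTE; rewrite -ltNge; lra.
have c2 : continuous (fun t : R => 2 * t).
  by apply: cts_mul => t; [exact: cvg_cst|exact: cvg_id].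
have c21 : continuous (fun t : R => 2 * t - 1).
  by apply: cts_sub => // t; exact: cvg_cst.
(* Pasting over two closed halves; at 1/2 the two formulas agree, both giving [g]. *)
pose A := [set p : R * X | p.1 <= 2^-1]; pose B := [set p : R * X | p.1 >= 2^-1].
have AB : A `|` B = setT.
  by apply/seteqP; split => // p _; case: (leP p.1 2^-1) => h1; [left|right; exact: ltW].
have clA : closed A.
  by apply: (@preimage_closed _ _ fst [set t : R | t <= 2^-1]);
    [move=> p _; exact: cvg_fst|exact: closed_le].
have clB : closed B.
  by apply: (@preimage_closed _ _ fst [set t : R | t >= 2^-1]);
    [move=> p _; exact: cvg_fst|exact: closed_ge].
suff: {within A `|` B, continuous G}.
  by rewrite AB => cG p; have := cG p; rewrite /continuous_at nbhs_subspaceT.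
have GA p : A p -> H (2 * p.1, p.2) = G p by rewrite /A /G /= => ->.
have GB p : B p -> K (2 * p.1 - 1, p.2) = G p.
  rewrite /B /G /= => h1; case: leP => // h2.
  have -> : p.1 = 2^-1 by apply/le_anti; rewrite h1 h2.
  by rewrite mulfV ?subrr ?K0 ?H1.
apply: withinU_continuous => //.
- apply: (@subspace_eq_continuous _ A _ _ _ _ (continuous_subspaceT (ghomotopic_reparam c2 cH))).
  by move=> p; rewrite inE; exact: GA.
- apply: (@subspace_eq_continuous _ B _ _ _ _ (continuous_subspaceT (ghomotopic_reparam c21 cK))).
  by move=> p; rewrite inE; exact: GB.
Qed.

End GlobalHomotopy.

(** * Barycentric coordinates on an order complex *)

Notation polyhedron R P := (set_type (realization R (order_complex P))).

Section Polyhedron.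
Context {R : realType} {d : Order.disp_t} {P : finPOrderType d}.
Implicit Types x : polyhedron R P.

Lemma polyhedronP (c : {ptws P -> R}) :
  realization R (order_complex P) c <->
  [/\ forall p, 0 <= c p, \sum_p c p = 1 &
      forall p q, c p != 0 -> c q != 0 -> (p >=< q)%O].
Proof.
split=> -[c0 c1 ch]; split => //.
  move=> p q cp cq; move: ch; rewrite inE => /forall_inP/(_ p).
  by rewrite inE => /(_ cp)/forall_inP/(_ q); rewrite inE; apply.
rewrite inE; apply/forall_inP => p; rewrite inE => cp.
by apply/forall_inP => q; rewrite inE => cq; apply: ch.
Qed.

Lemma poly_ge0 x p : 0 <= val x p.
Proof. by have /set_mem/polyhedronP[] := valP x. Qed.

Lemma poly_sum x : \sum_p val x p = 1.
Proof. by have /set_mem/polyhedronP[] := valP x. Qed.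

Lemma poly_chain x p q : val x p != 0 -> val x q != 0 -> (p >=< q)%O.
Proof. by have /set_mem/polyhedronP[_ _] := valP x; apply. Qed.

Lemma poly_coord_cts p : continuous (fun x => val x p).
Proof.
move=> x; apply: (@continuous_comp _ _ _ set_val (fun c : {ptws P -> R} => c p)).
  exact: cts_set_val.
exact: cts_ptws_proj.
Qed.

Lemma poly_cts (T : topologicalType) (f : T -> polyhedron R P) :
  (forall p, continuous (fun t => val (f t) p)) -> continuous f.
Proof. by move=> cf; apply: cts_set_type; apply: cts_ptws. Qed.

Lemma poly_eq x y : (forall p, val x p = val y p) -> x = y.
Proof. by move=> xy; apply/val_inj/funext. Qed.

Definition mk_poly (c : {ptws P -> R}) (h : realization R (order_complex P) c) :
  polyhedron R P := exist _ c (mem_set h).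

End Polyhedron.

Lemma sum_neq0 (R : realType) (I : finType) (P : pred I) (F : I -> R) :
  \sum_(i | P i) F i != 0 -> exists2 i, P i & F i != 0.
Proof.
move=> h; apply/exists_inP; apply: contraNT h => /exists_inPn h.
by rewrite big1 // => i /h /negPn/eqP.
Qed.

Lemma sum_fiber (R : realType) (I J : finType) (f : I -> J) (F : I -> R) :
  \sum_j \sum_(i | f i == j) F i = \sum_i F i.
Proof. by rewrite [RHS](partition_big f predT). Qed.

(** * Maps induced by monotone maps, and the prism homotopy *)

Section Functor.
Context {R : realType} {d d' : Order.disp_t} {P : finPOrderType d} {Q : finPOrderType d'}.

(** This is the affine extension of the simplicial map: masses are pushed forward along [f], and the
    image of a chain is a chain. *)
Lemma poly_map_subproof (f : P -> Q) (fh : {homo f : x y / (x <= y)%O}) (x : polyhedron R P) :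
  realization R (order_complex Q) (fun q => \sum_(p | f p == q) val x p).
Proof.
apply/polyhedronP; split => [q||q q'].
- by apply: sumr_ge0 => p _; apply: poly_ge0.
- by rewrite sum_fiber poly_sum.
move=> /sum_neq0[p /eqP<- xp] /sum_neq0[p' /eqP<- xp'].
by case/orP: (poly_chain xp xp') => /fh h; rewrite /Order.comparable h ?orbT.
Qed.

Definition poly_map (f : P -> Q) fh x : polyhedron R Q := mk_poly (@poly_map_subproof f fh x).

Lemma poly_map_cts f fh : continuous (@poly_map f fh).
Proof.
by apply: poly_cts => q; apply: cts_sum => p; apply: poly_coord_cts.
Qed.

(* The homotopy moves the top part of total mass [t] of the chain by [g] and
   the remaining bottom part by [f]; [low t x p] is the share of the vertex [p]
   in the bottom part. *)
Definition low (t : R) (x : polyhedron R P) (p : P) : R :=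
  Num.max 0 (Num.min (val x p) (1 - t - \sum_(q | (q < p)%O) val x q)).

Lemma low_ge0 t x p : 0 <= low t x p.
Proof. by rewrite /low le_max lexx. Qed.

Lemma low_le t x p : low t x p <= val x p.
Proof. by rewrite /low ge_max poly_ge0 ge_min lexx. Qed.

Lemma low0 x p : low 0 x p = val x p.
Proof.
(* At [t = 0] the cut is at height 1, the total mass, so no vertex reaches beyond it. *)
have sub : val x p + \sum_(q | (q < p)%O) val x q <= 1.
  rewrite -(poly_sum x) [leRHS](bigD1 p) //= lerD2l [leRHS](bigID (fun q => (q < p)%O)) /=.
  rewrite [X in X + _](eq_bigl (fun q => (q < p)%O)).
    by rewrite lerDl sumr_ge0 // => q _; apply: poly_ge0.
  by move=> q; rewrite lt_neqAle; case: eqVneq => //= _; case: (_ <= _)%O.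
rewrite /low min_l ?max_r ?poly_ge0 //.
by rewrite subr0 lerBrDr.
Qed.

Lemma low1 x p : low 1 x p = 0.
Proof.
by rewrite /low max_l // ge_min subrr sub0r oppr_le0 sumr_ge0 ?orbT // => q _; apply: poly_ge0.
Qed.

(** If [p] has a share in the bottom part, the mass strictly below [p] is less than [1 - t]; this
    mass includes [q] and everything below it. *)
Lemma low_lt t x p q : (q < p)%O -> low t x p != 0 -> low t x q = val x q.
Proof.
move=> qp lp; have : 0 < 1 - t - \sum_(r | (r < p)%O) val x r.
  rewrite ltNge; apply: contraNN lp => h; rewrite /low max_l //.
  by rewrite ge_min h orbT.
have sub : \sum_(r | (r < q)%O) val x r + val x q <= \sum_(r | (r < p)%O) val x r.
  rewrite [leRHS](bigD1 q) //= [leLHS]addrC lerD2l.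
  rewrite [leRHS](bigID (fun r => (r < q)%O)) /=.
  rewrite [X in X + _](eq_bigl (fun r => (r < q)%O)).
    by rewrite lerDl sumr_ge0 // => r _; apply: poly_ge0.
  move=> r; case rq: (r < q)%O; rewrite ?andbF ?andbT //.
  by rewrite (lt_trans rq qp) (lt_eqF rq).
move=> h; rewrite /low min_l ?max_r ?poly_ge0 //; lra.
Qed.

Lemma low_cts p : continuous (fun z : R * polyhedron R P => low z.1 z.2 p).
Proof.
have cx q : continuous (fun z : R * polyhedron R P => val z.2 q).
  move=> z; apply: (@continuous_comp _ _ _ snd (fun x : polyhedron R P => val x q)).
    exact: cvg_snd.
  exact: poly_coord_cts.
apply: cts_max; first by move=> z; exact: cvg_cst.
apply: cts_min => //; apply: cts_sub; last by apply: cts_sum.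
by apply: cts_sub => z; [exact: cvg_cst|exact: cvg_fst].
Qed.

Section Prism.
Variables (f g : P -> Q).
Hypothesis fh : {homo f : x y / (x <= y)%O}.
Hypothesis gh : {homo g : x y / (x <= y)%O}.
Hypothesis fg : forall p, (f p <= g p)%O.

Definition prism_coord (t : R) (x : polyhedron R P) (q : Q) : R :=
  \sum_(p | f p == q) low t x p + \sum_(p | g p == q) (val x p - low t x p).

Lemma prism_subproof t x : realization R (order_complex Q) (prism_coord t x).
Proof.
apply/polyhedronP; split => [q||q q'].
- by rewrite addr_ge0 // sumr_ge0 // => p _; rewrite ?subr_ge0 ?low_le ?low_ge0.
- by rewrite big_split /= !sum_fiber sumrB poly_sum addrC subrK.
have lx p : low t x p != 0 -> val x p != 0.
  by apply: contraNN => /eqP xp; rewrite eq_le low_ge0 andbT -[leRHS]xp low_le.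
have lx' p : val x p - low t x p != 0 -> val x p != 0.
  apply: contraNN => /eqP xp; rewrite xp sub0r oppr_eq0 eq_le low_ge0 andbT.
  by rewrite -[leRHS]xp low_le.
have cases r : prism_coord t x r != 0 ->
    (exists2 p, f p = r & low t x p != 0) \/
    (exists2 p, g p = r & val x p - low t x p != 0).
  rewrite /prism_coord.
  have [->|/sum_neq0[p /eqP fp lp]] := eqVneq (\sum_(p | f p == r) low t x p) 0;
    last by left; exists p.
  by rewrite add0r => /sum_neq0[p /eqP gp lp]; right; exists p.
(* A vertex with a top share is not strictly below one with a bottom share, by [low_lt]. So p <= p',
   whence f p <= g p <= g p'. *)
have mixed p p' : low t x p != 0 -> val x p' - low t x p' != 0 -> (f p >=< g p')%O.
  move=> lp lp'; have /orP[pp|] := poly_chain (lx _ lp) (lx' _ lp').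
    by rewrite /Order.comparable (le_trans (fg p) (gh pp)).
  rewrite le_eqVlt => /predU1P[->|pp]; first by rewrite /Order.comparable fg.
  by rewrite (low_lt pp lp) subrr eqxx in lp'.
case/cases=> -[p <- lp] /cases[] [p' <- lp'].
- by case/orP: (poly_chain (lx _ lp) (lx _ lp')) => /fh h; rewrite /Order.comparable h ?orbT.
- exact: mixed.
- by rewrite comparable_sym mixed.
- by case/orP: (poly_chain (lx' _ lp) (lx' _ lp')) => /gh h; rewrite /Order.comparable h ?orbT.
Qed.

Lemma poly_map_homotopic : ghomotopic R (poly_map fh) (poly_map gh).
Proof.
exists (fun z => mk_poly (prism_subproof z.1 z.2)); split => [|x|x].
- apply: poly_cts => q; apply: cts_add; apply: cts_sum => p.
    exact: low_cts.
  apply: cts_sub; last exact: low_cts.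
  move=> z; apply: (@continuous_comp _ _ _ snd (fun x : polyhedron R P => val x p)).
    exact: cvg_snd.
  exact: poly_coord_cts.
- apply: poly_eq => q /=; rewrite /prism_coord [X in _ + X]big1 ?addr0.
    by apply: eq_bigr => p _; rewrite low0.
  by move=> p _; rewrite low0 subrr.
- apply: poly_eq => q /=; rewrite /prism_coord [X in X + _]big1 ?add0r.
    by apply: eq_bigr => p _; rewrite low1 subr0.
  by move=> p _; rewrite low1.
Qed.

End Prism.

End Functor.

Lemma poly_map_id (R : realType) d (P : finPOrderType d) (f : P -> P)
  (fh : {homo f : x y / (x <= y)%O}) : f =1 id -> @poly_map R _ _ _ _ f fh =1 id.
Proof.
move=> fE x; apply: poly_eq => q /=.
by rewrite (big_pred1 q) // => p; rewrite fE.
Qed.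

(** The composite is a separate map [h], so that pointwise identities such as those of the
    retraction apply directly. *)
Lemma poly_map_comp (R : realType) d d' d'' (P : finPOrderType d) (Q : finPOrderType d')
  (S : finPOrderType d'') (f : P -> Q) (g : Q -> S) (h : P -> S) fh gh hh :
  (forall p, g (f p) = h p) ->
  forall x, @poly_map R _ _ _ _ g gh (@poly_map R _ _ _ _ f fh x) = @poly_map R _ _ _ _ h hh x.
Proof.
move=> gf x; apply: poly_eq => s /=.
rewrite [RHS](partition_big f (fun q => g q == s)) => [|p]; last by rewrite gf.
apply: eq_bigr => q /eqP gq; apply: eq_bigl => p.
by have [e|] := eqVneq (f p) q; rewrite ?andbF // -gf e gq eqxx.
Qed.

(** * The proper part of a Boolean lattice *)

Section Layers.
Context {R : realType} {N : nat}.
Local Notation B := (boolean_proper N).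
Implicit Types (x : B -> R) (y : 'I_N -> R) (S T : B).

Definition level_sum x (m : 'I_N) : R := \sum_(S : B | m \in val S) x S.

Definition spread y : R := \sum_(p : 'I_N * 'I_N) `|y p.1 - y p.2|.

(* The default value [spread y] dominates all the differences, so that it does
   not affect the minimum. *)
Definition layer y S : R :=
  Num.max 0 (\big[Num.min/spread y]_(p : 'I_N * 'I_N | (p.1 \in val S) && (p.2 \notin val S))
               (y p.1 - y p.2)).

Lemma layer_ge0 y S : 0 <= layer y S.
Proof. by rewrite /layer le_max lexx. Qed.

Lemma spread_ge y m m' : y m - y m' <= spread y.
Proof.
apply: le_trans (ler_norm _) _; rewrite /spread (bigD1 (m, m')) //= lerDl.
by apply: sumr_ge0.
Qed.

Lemma layer_eq y S a m m' : 0 <= a ->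
  (forall i j, i \in val S -> j \notin val S -> a <= y i - y j) ->
  m \in val S -> m' \notin val S -> y m - y m' = a -> layer y S = a.
Proof.
move=> a0 ya mS mS' e; rewrite /layer; set b := bigop _ _ _.
suff -> : b = a by rewrite max_r.
apply/le_anti/andP; split.
  rewrite -e; apply: (@bigmin_le_cond _ _ _ _ (m, m') _ (fun p => y p.1 - y p.2)) => /=.
  by rewrite mS.
apply: le_bigmin; first by rewrite -e spread_ge.
by move=> [i j] /andP[] /=; apply: ya.
Qed.

Lemma layer_eq0 y S m m' : m \in val S -> m' \notin val S -> y m <= y m' ->
  layer y S = 0.
Proof.
move=> mS mS' e; rewrite /layer max_l //.
apply: (@le_trans _ _ (y m - y m')); last by rewrite subr_le0.
apply: (@bigmin_le_cond _ _ _ _ (m, m') _ (fun p => y p.1 - y p.2)) => /=.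
by rewrite mS.
Qed.

Lemma level_sum_sub x i j :
  level_sum x i - level_sum x j = \sum_(T : B) x T * ((i \in val T)%:R - (j \in val T)%:R).
Proof.
have E m : level_sum x m = \sum_(T : B) x T * (m \in val T)%:R.
  by rewrite /level_sum big_mkcond; apply: eq_bigr => T _; case: (m \in _); rewrite ?mulr1 ?mulr0.
by rewrite !E -sumrB; apply: eq_bigr => T _; rewrite mulrBr.
Qed.

(** The largest member of the chain strictly below [S] misses an element of [S], and all smaller
    members miss it too. If there is no such member, any element of the nonempty [S] serves. *)
Lemma chain_inside x S :
  (forall T, x T != 0 -> (S >=< T)%O) ->
  (forall T T', x T != 0 -> x T' != 0 -> (T >=< T')%O) ->
  exists2 m, m \in val S & forall T, x T != 0 -> (T < S)%O -> m \notin val T.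
Proof.
move=> Sc Tc; pose P T := (x T != 0) && (T < S)%O.
have /andP[/set0Pn[m0 m0S] _] := valP S.
case: (pickP P) => [T0 PT0|P0]; last first.
  by exists m0 => // T xT TS; have := P0 T; rewrite /P xT TS.
case: (@arg_maxnP _ T0 P (fun T => #|val T|)) => // T1 /andP[xT1 T1S] T1max.
have /fintype.subsetPn[m mS mT1] : ~~ (val S \subset val T1).
  by apply/negP; rewrite -boolean_leE => /(lt_le_trans T1S); rewrite ltxx.
exists m => // T xT TS; apply: contraNN mT1 => mT.
case/orP: (Tc _ _ xT xT1); rewrite boolean_leE => TT1.
  exact: (fintype.subsetP TT1).
have PT : P T by rewrite /P xT TS.
have /eqP -> // : val T1 == val T by rewrite eqEcard TT1; apply: T1max.
Qed.

(** Dually, the smallest member of the chain strictly above [S] has an element outside [S], shared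
    by all larger members. *)
Lemma chain_outside x S :
  (forall T, x T != 0 -> (S >=< T)%O) ->
  (forall T T', x T != 0 -> x T' != 0 -> (T >=< T')%O) ->
  exists2 m, m \notin val S & forall T, x T != 0 -> (S < T)%O -> m \in val T.
Proof.
move=> Sc Tc; pose P T := (x T != 0) && (S < T)%O.
have [m0 m0S] : exists m, m \notin val S.
  have /andP[_] := valP S; rewrite -finset.subTset => /fintype.subsetPn[m _ mS].
  by exists m.
case: (pickP P) => [T0 PT0|P0]; last first.
  by exists m0 => // T xT TS; have := P0 T; rewrite /P xT TS.
case: (@arg_minnP _ T0 P (fun T => #|val T|)) => // T1 /andP[xT1 T1S] T1min.
have /fintype.subsetPn[m mT1 mS] : ~~ (val T1 \subset val S).
  by apply/negP; rewrite -boolean_leE => /le_lt_trans /(_ T1S); rewrite ltxx.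
exists m => // T xT TS.
case/orP: (Tc _ _ xT1 xT); rewrite boolean_leE => TT1.
  exact: (fintype.subsetP TT1).
have PT : P T by rewrite /P xT TS.
have /eqP -> // : val T == val T1 by rewrite eqEcard TT1; apply: T1min.
Qed.

(** Uniqueness of the layer-cake decomposition: [layer y S] is the length of the interval of
    thresholds at which the superlevel set of [y] is [S]. *)
Lemma layer_level_sum x y (c : R) S : (forall T, 0 <= x T) ->
  (forall T T', x T != 0 -> x T' != 0 -> (T >=< T')%O) ->
  (forall m, y m = c + level_sum x m) -> layer y S = x S.
Proof.
move=> x0 xc yE.
have yB i j : y i - y j = \sum_(T : B) x T * ((i \in val T)%:R - (j \in val T)%:R).
  by rewrite !yE -level_sum_sub; ring.
case: (boolP [forall T, (x T != 0) ==> (S >=< T)%O]) => [/forallP Sc|]; last first.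
  rewrite negb_forall => /existsP[T]; rewrite negb_imply => /andP[xT].
  rewrite /Order.comparable negb_or !boolean_leE => /andP[].
  move=> /fintype.subsetPn[i iS iT] /fintype.subsetPn[j jT jS].
  have -> : x S = 0.
    apply/eqP; apply: contraNT iT => /(xc _ _ xT) /orP[]; rewrite boolean_leE => /fintype.subsetP h.
      by rewrite h in jS.
    exact: h.
  (* Each member of the support is comparable with [T], so it contains [j] or misses [i]; hence y i
     <= y j. *)
  apply: (layer_eq0 iS jS); rewrite -subr_le0 yB sumr_le0 // => T' _.
  have [->|xT'] := eqVneq (x T') 0; first by rewrite mul0r.
  rewrite mulr_ge0_le0 // subr_le0 ler_nat.
  case/orP: (xc _ _ xT xT'); rewrite boolean_leE => /fintype.subsetP h.
    by rewrite (h j jT) leq_b1.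
  by rewrite (contraNF (h i) iT).
have {}Sc T : x T != 0 -> (S >=< T)%O by move=> xT; have := Sc T; rewrite xT.
(* The minimum is attained at [m], [m']: members above [S] contain both and members below contain
   neither, so only [S] contributes to y m - y m'. *)
have [m mS min] := chain_inside Sc xc; have [m' mS' mout] := chain_outside Sc xc.
have term i j T : i \in val S -> j \notin val S -> T != S ->
    0 <= x T * ((i \in val T)%:R - (j \in val T)%:R).
  move=> iS jS TS; have [->|xT] := eqVneq (x T) 0; first by rewrite mul0r.
  rewrite mulr_ge0 // subr_ge0 ler_nat.
  case/orP: (Sc _ xT); rewrite boolean_leE => /fintype.subsetP h.
    by rewrite (h i iS) leq_b1.
  by rewrite (contraNF (h j) jS).
apply: (layer_eq (x0 S) _ mS mS').
  move=> i j iS jS; rewrite yB (bigD1 S) //= iS (negPf jS) subr0 mulr1 lerDl.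
  by apply: sumr_ge0 => T TS; apply: term.
rewrite yB (bigD1 S) //= mS (negPf mS') subr0 mulr1 big1 ?addr0 // => T TS.
have [->|xT] := eqVneq (x T) 0; first by rewrite mul0r.
case/orP: (Sc _ xT) => h.
  have ST : (S < T)%O by rewrite lt_neqAle eq_sym TS.
  by rewrite mout // (fintype.subsetP h) // subrr mulr0.
have ST : (T < S)%O by rewrite lt_neqAle TS.
have nT : m' \notin val T by apply: contraNN mS'; apply: (fintype.subsetP h).
by rewrite (negPf (min _ xT ST)) (negPf nT) subrr mulr0.
Qed.


(** Induction on the support [s] of [w]: its least value [a] there becomes the mass of [s] and is
    subtracted on [s]. The zero at [m0] keeps [s] a proper subset. *)
Lemma level_sum_onto_ge0 (w : 'I_N -> R) m0 : (forall m, 0 <= w m) -> w m0 = 0 ->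
  exists x : B -> R, [/\ forall T, 0 <= x T,
    forall T T', x T != 0 -> x T' != 0 -> (T >=< T')%O
    & forall m, w m = level_sum x m].
Proof.
have [d] := ubnP #|[set m | w m != 0]%SET|; elim: d w => // d IHd w wd w0 wm0.
pose s := [set m | w m != 0]%SET.
have [s0|sN0] := eqVneq s finset.set0.
  exists (fun=> 0); split => // [T T'|m]; first by rewrite eqxx.
  by rewrite /level_sum big1 //; apply/eqP/negPn; move/setP/(_ m): s0; rewrite !finset.inE => ->.
have sP : (s != finset.set0) && (s != [set: 'I_N]%SET).
  rewrite sN0; apply/eqP => /setP/(_ m0); by rewrite !finset.inE wm0 eqxx.
pose S : B := Sub s sP.
have [m1 m1s] : exists m1, m1 \in s by apply/set0Pn.
have [m2 m2s m2min] := @arg_minP _ _ _ m1 (fun m => m \in s) w m1s.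
pose a := w m2; have a0 : 0 < a.
  by rewrite lt_def w0 andbT; move: m2s; rewrite finset.inE.
pose w' m := if m \in s then w m - a else 0.
have w'0 m : 0 <= w' m by rewrite /w'; case: ifP => // ms; rewrite subr_ge0 m2min.
have [||x [x0 xc xE]] := IHd w' _ w'0.
- rewrite -ltnS; apply: leq_trans wd; rewrite ltnS; apply: proper_card.
  apply/properP; split.
    apply/fintype.subsetP => m; rewrite !finset.inE /w' !finset.inE.
    by case: ifP => //; rewrite eqxx.
  by exists m2 => //; rewrite finset.inE /w' m2s subrr eqxx.
- by rewrite /w' finset.inE wm0 eqxx.
(* The remaining masses sit on subsets of [s] that miss the minimizer [m2], hence strictly below [s]
   in the chain. *)
have xS T : x T != 0 -> val T \subset s /\ m2 \notin val T.
  move=> xT.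
  have w'T m : m \in val T -> w' m != 0.
    move=> mT; rewrite xE /level_sum (bigD1 T) //= paddr_eq0 ?x0 ?sumr_ge0 //.
    by rewrite (negPf xT).
  split; last by apply/negP => /w'T; rewrite /w' m2s subrr eqxx.
  by apply/fintype.subsetP => m /w'T; rewrite /w'; case: ifP => //; rewrite eqxx.
have xSS : x S = 0 by apply/eqP/negPn/negP => /xS[_]; rewrite m2s.
exists (fun T => if T == S then a else x T); split.
- by move=> T; case: ifP => // _; exact: ltW.
- move=> T T'; case: (eqVneq T S) => [->|_]; case: (eqVneq T' S) => [->|_] //=.
  + by rewrite /Order.comparable lexx.
  + by move=> _ /xS[h _]; rewrite comparable_sym /Order.comparable boolean_leE h.
  + by move=> /xS[h _] _; rewrite /Order.comparable boolean_leE h.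
  + exact: xc.
move=> m; rewrite /level_sum.
have e : \sum_(T : B | (m \in val T) && (T != S)) (if T == S then a else x T) = w' m.
  rewrite xE /level_sum [RHS](bigID (fun T => T == S)) /=.
  rewrite [X in _ = X + _]big1 ?add0r => [|T /andP[_ /eqP->] //].
  by apply: eq_bigr => T /andP[_ /negPf->].
rewrite (bigID (fun T => T == S)) /= e.
have [ms|ms] := boolP (m \in s).
  rewrite (big_pred1 S) ?eqxx => [|T]; first by rewrite /w' ms; ring.
  by rewrite /=; case: (eqVneq T S) => [->|_]; rewrite ?andbF ?andbT /=.
rewrite big1 => [|T /andP[+ /eqP TS]]; last by rewrite TS (negPf ms).
by rewrite /w' (negPf ms) addr0; apply/eqP/negPn; move: ms; rewrite finset.inE.
Qed.

Lemma level_sum_onto y (m0 : 'I_N) : exists c x,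
  [/\ forall T, 0 <= x T, forall T T', x T != 0 -> x T' != 0 -> (T >=< T')%O
    & forall m, y m = c + level_sum x m].
Proof.
have [m1 _ m1min] := @arg_minP _ _ _ m0 predT y isT.
have [||x [x0 xc xE]] := @level_sum_onto_ge0 (fun m => y m - y m1) m1.
- by move=> m; rewrite subr_ge0 m1min.
- by rewrite subrr.
by exists (y m1), x; split => // m; rewrite -xE addrC subrK.
Qed.

End Layers.

(** * The homeomorphism with the unit sphere *)

Section Sphere.
Context {R : realType} {d : nat}.
Local Notation B := (boolean_proper d.+1).
Local Notation sphere := (set_type (unit_sphere R d)).
Implicit Types (x : polyhedron R B) (z : sphere).

Lemma sphere_sum z : \sum_i val z 0 i ^+ 2 = 1.
Proof. exact: (set_mem (valP z)). Qed.

(** Coordinates on the space of vectors modulo constant vectors; [layer] depends on differences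
    only. *)
Definition drift (y : 'I_d.+1 -> R) (j : 'I_d) : R := y (lift ord0 j) - y ord0.

Definition drift_norm (y : 'I_d.+1 -> R) : R := Num.sqrt (\sum_j drift y j ^+ 2).

Lemma layer_cst (y : 'I_d.+1 -> R) (S : B) : (forall j, drift y j = 0) -> layer y S = 0.
Proof.
move=> y0; apply: (@layer_level_sum _ _ (fun=> 0) y (y ord0)) => // [T T'|m].
  by rewrite eqxx.
rewrite /level_sum big1 // addr0.
case: (unliftP ord0 m) => [j ->|-> //].
by apply/eqP; rewrite -subr_eq0 -/(drift y j) y0.
Qed.

Lemma layer_poly (x : polyhedron R B) y c a S : 0 <= a ->
  (forall m, y m = c + a * level_sum (val x) m) -> layer y S = a * val x S.
Proof.
move=> a0 yE; apply: (@layer_level_sum _ _ (fun T => a * val x T) y c) => [T|T T'|m].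
- by rewrite mulr_ge0 ?poly_ge0.
- by rewrite !mulf_eq0 !negb_or => /andP[_ xT] /andP[_ xT']; apply: (poly_chain xT xT').
- by rewrite yE /level_sum mulr_sumr.
Qed.

(** With zero drift the level sums would be constant and all layers zero, but the layers are the
    masses of [x], of sum 1. *)
Lemma drift_norm_gt0 x : 0 < drift_norm (level_sum (val x)).
Proof.
rewrite sqrtr_gt0 lt_def sumr_ge0 ?andbT => [|j _]; last exact: sqr_ge0.
apply/negP => /eqP/psumr_eq0P h.
suff x0 S : val x S = 0.
  by have := poly_sum x; rewrite big1 // => /esym/eqP; rewrite oner_eq0.
rewrite -(mul1r (val x S)) -(@layer_poly x (level_sum (val x)) 0 1 S) ?ler01 //.
  by apply: layer_cst => j; apply/eqP; rewrite -sqrf_eq0 h // => i _; exact: sqr_ge0.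
by move=> m; rewrite add0r mul1r.
Qed.

Lemma to_sphere_subproof x :
  unit_sphere R d (\row_j (drift (level_sum (val x)) j / drift_norm (level_sum (val x)))).
Proof.
rewrite /unit_sphere /=.
under eq_bigr do rewrite mxE expr_div_n.
rewrite -mulr_suml sqr_sqrtr; last by rewrite sumr_ge0 // => j _; exact: sqr_ge0.
by have := drift_norm_gt0 x; rewrite sqrtr_gt0 => n0; rewrite mulfV // gt_eqF.
Qed.

Definition to_sphere x : sphere :=
  exist (fun u => u \in unit_sphere R d) _ (mem_set (to_sphere_subproof x)).

(** The representative, modulo constants, that vanishes at index 0 and has drift [z]. *)
Definition extend0 (z : 'rV[R]_d) (m : 'I_d.+1) : R :=
  if unlift ord0 m is Some j then z 0 j else 0.

Lemma extend0_lift (z : 'rV[R]_d) j : extend0 z (lift ord0 j) = z 0 j.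
Proof. by rewrite /extend0 liftK. Qed.

Lemma extend0_0 (z : 'rV[R]_d) : extend0 z ord0 = 0.
Proof. by rewrite /extend0 unlift_none. Qed.

Definition layer_total y : R := \sum_(S : B) layer y S.

(** The total is positive because otherwise [extend0] would be constant, hence zero, against the
    norm 1 of [z]. *)
Lemma sphere_level_sum z : exists c (x : B -> R),
  [/\ forall T, 0 <= x T, forall T T', x T != 0 -> x T' != 0 -> (T >=< T')%O,
      forall m, extend0 (val z) m = c + level_sum x m,
      forall S, layer (extend0 (val z)) S = x S & 0 < layer_total (extend0 (val z))].
Proof.
have [c [x [x0 xc xE]]] := level_sum_onto (extend0 (val z)) ord0.
have lx S : layer (extend0 (val z)) S = x S := layer_level_sum S x0 xc xE.
exists c, x; split => //.
rewrite lt_def sumr_ge0 ?andbT => [|S _]; last exact: layer_ge0.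
apply/negP => /eqP/psumr_eq0P h.
have {}h S : x S = 0 by rewrite -lx h // => T _; exact: layer_ge0.
have {}xE m : extend0 (val z) m = c by rewrite xE /level_sum big1 ?addr0.
have c0 : c = 0 by rewrite -(xE ord0) extend0_0.
have := sphere_sum z; rewrite big1 => [/esym/eqP|i _]; first by rewrite oner_eq0.
by rewrite -extend0_lift xE c0 expr0n.
Qed.

Lemma from_sphere_subproof z : realization R (order_complex B)
  (fun S => layer (extend0 (val z)) S / layer_total (extend0 (val z))).
Proof.
have [c [x [x0 xc xE lx L0]]] := sphere_level_sum z.
apply/polyhedronP; split => [S||S S'].
- by rewrite divr_ge0 ?layer_ge0 ?ltW.
- by rewrite -mulr_suml mulfV // gt_eqF.
- by rewrite !mulf_eq0 !negb_or !lx => /andP[h _] /andP[h' _]; apply: xc.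
Qed.

Definition from_sphere z : polyhedron R B := mk_poly (from_sphere_subproof z).

Lemma from_sphereK : cancel from_sphere to_sphere.
Proof.
move=> z; apply: val_inj; apply/rowP => j; rewrite /= mxE.
have [c [x [x0 xc xE lx L0]]] := sphere_level_sum z.
set L := layer_total _ in L0.
(* The constant [c] cancels in the drift, which leaves [z] scaled by 1/L; normalization then removes
   the factor. *)
have dE i : drift (level_sum (val (from_sphere z))) i = val z 0 i / L.
  have lE m : level_sum (val (from_sphere z)) m = (extend0 (val z) m - c) / L.
    rewrite xE addrC addKr /level_sum mulr_suml.
    by apply: eq_bigr => S _ /=; rewrite lx.
  by rewrite /drift !lE extend0_lift extend0_0 -mulrBl opprB addrA subrK subr0.
have nE : drift_norm (level_sum (val (from_sphere z))) = L^-1.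
  rewrite /drift_norm; under eq_bigr do rewrite dE expr_div_n.
  by rewrite -mulr_suml sphere_sum mul1r -exprVn sqrtr_sqr ger0_norm // invr_ge0 ltW.
by rewrite dE nE invrK divfK // gt_eqF.
Qed.

Lemma to_sphereK : cancel to_sphere from_sphere.
Proof.
move=> x; apply: poly_eq => S /=.
set y := level_sum (val x); set nu := drift_norm y.
have nu0 : 0 < nu := drift_norm_gt0 x.
(* The extended vector is (y - y 0) / nu, a positive multiple of the level sums up to a constant;
   the factor cancels against the total. *)
have lE T : layer (extend0 (val (to_sphere x))) T = nu^-1 * val x T.
  apply: (@layer_poly _ _ (- (y ord0 / nu))) => [|m]; first by rewrite invr_ge0 ltW.
  case: (unliftP ord0 m) => [j ->|->]; last by rewrite extend0_0 mulrC addNr.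
  by rewrite extend0_lift /= mxE -/y -/nu /drift mulrBl addrC (mulrC nu^-1).
rewrite /layer_total; under eq_bigr do rewrite lE.
by rewrite lE -mulr_sumr poly_sum mulr1 mulrAC mulfV ?mul1r // invr_eq0 gt_eqF.
Qed.

Lemma to_sphere_cts : continuous to_sphere.
Proof.
have cl m : continuous (fun x => level_sum (val x) m).
  by apply: cts_sum => S; exact: poly_coord_cts.
have cd j : continuous (fun x => drift (level_sum (val x)) j) by apply: cts_sub.
apply: cts_set_type; apply: cts_rV => j.
rewrite (_ : (fun _ => _) =
  (fun x => drift (level_sum (val x)) j / drift_norm (level_sum (val x)))); last first.
  by apply/funext => x /=; rewrite mxE.
apply: cts_div => // [x|]; first by rewrite gt_eqF // drift_norm_gt0.
move=> x; apply: (@continuous_comp _ _ _ (fun x => \sum_j drift (level_sum (val x)) j ^+ 2)).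
  by apply: cts_sum => i; apply: cts_mul.
exact: sqrt_continuous.
Qed.

Lemma from_sphere_cts : continuous from_sphere.
Proof.
have ce m : continuous (fun z => extend0 (val z) m).
  rewrite /extend0; case: (unlift ord0 m) => [j|]; last exact: cts_cst.
  move=> z; apply: (@continuous_comp _ _ _ set_val (fun u : 'rV[R]_d => u 0 j)).
    exact: cts_set_val.
  exact: coord_continuous.
have cl S : continuous (fun z => layer (extend0 (val z)) S).
  apply: cts_max; first exact: cts_cst.
  apply: cts_bigmin => [|p]; last exact: cts_sub.
  by apply: cts_sum => p; apply: cts_norm; apply: cts_sub.
apply: poly_cts => S; apply: cts_div => // [z|]; last exact: cts_sum.
by have [c [x [_ _ _ _ L0]]] := sphere_level_sum z; rewrite gt_eqF.
Qed.

End Sphere.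

(** * Assembly of the homotopy equivalence *)

Section BruhatSphere.
Variables (R : realType) (n k : nat).

Definition level_poly b j : polyhedron R (proper_part n k) -> polyhedron R (proper_part n k) :=
  poly_map (@proper_level_homo n k b j).

(** Each increment of [j] passes through the common upper bound [level_poly true j]. *)
Lemma level_poly_homotopic j : ghomotopic R (level_poly false 0) (level_poly false j).
Proof.
elim: j => [|j IHj]; first by apply: ghomotopic_eq => //; exact: poly_map_cts.
apply: ghomotopic_trans IHj _.
apply: (@ghomotopic_trans _ _ _ _ (level_poly true j)).
  exact/poly_map_homotopic/proper_level_false_true.
exact/ghomotopic_sym/poly_map_homotopic/proper_levelS_false_true.
Qed.

End BruhatSphere.

End Topology.

Theorem mainTheorem2 (R : realType) (n k : nat) (hnk : k.+1 <= n) :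
  homotopy_equivalent R
    (set_type (realization R (order_complex (proper_part n k))))
    (set_type (unit_sphere R (n - k - 1))).
Proof.
(* The n - k levels index a Boolean lattice whose sphere lies in a space of dimension one less than
   their number. *)
have nE : n = (k + (n - k - 1).+1)%N by lia.
pose top := poly_map (R := R) (@proper_top_homo n k _ nE).
pose fill := poly_map (R := R) (@proper_fill_homo n k _ nE).
have topc : continuous top := poly_map_cts (R := R) (fh := _).
have fillc : continuous fill := poly_map_cts (R := R) (fh := _).
have comp_cts (X Y Z : topologicalType) (f : X -> Y) (g : Y -> Z) :
    continuous f -> continuous g -> continuous (g \o f).
  by move=> cf cg x; apply: continuous_comp; [exact: cf|exact: cg].
have fillK z : top (fill z) = z.
  rewrite /top /fill (@poly_map_comp _ _ _ _ _ _ _ _ _ id _ _ (fun _ _ => id)).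
    exact: poly_map_id.
  exact: proper_fillK.
have topK x : fill (top x) = @level_poly R n k false 0 x.
  by apply: poly_map_comp => p; apply: proper_topK.
exists (to_sphere \o top), (fill \o from_sphere); split.
- by apply: comp_cts => //; exact: to_sphere_cts.
- by apply: comp_cts => //; exact: from_sphere_cts.
(* The composite equals the map for [j = 0], which is homotopic to that for [j = n], the identity.
   The composite on the sphere is the identity on the nose. *)
- apply: ghomotopicW; apply: (@ghomotopic_trans _ _ _ _ (@level_poly R n k false 0)).
    apply: ghomotopic_eq => [|x /=]; last by rewrite to_sphereK topK.
    apply: (comp_cts _ _ _ (to_sphere \o top) (fill \o from_sphere)).
      by apply: comp_cts => //; exact: to_sphere_cts.
    by apply: comp_cts => //; exact: from_sphere_cts.
  apply: ghomotopic_trans (level_poly_homotopic R n k n) _.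
  apply: ghomotopic_eq; first exact: poly_map_cts.
  by apply: poly_map_id => x; apply: proper_level_id.
- apply: ghomotopicW; apply: ghomotopic_eq => [|z /=]; last by rewrite fillK from_sphereK.
  apply: (comp_cts _ _ _ (fill \o from_sphere) (to_sphere \o top)).
    by apply: comp_cts => //; exact: from_sphere_cts.
  by apply: comp_cts => //; exact: to_sphere_cts.
Qed.
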